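(* Let $n\ge 1$. Every $n$-qubit stabilizer circuit can be written, up to a global phase and multiplication by an $n$-qubit Pauli operator, as a 7-stage layered circuit of the form -C-CZ-P-H-P-CZ-C-. Moreover, every $n$-qubit stabilizer circuit is executable in the Linear Nearest Neighbor architecture as a circuit over $\{\mathrm{H},\mathrm{P},\mathrm{CNOT}\}$ of two-qubit gate depth at most $14n-4$.
   Context: Stabilizer circuits on $n$ qubits are circuits composed of the Hadamard gate $\mathrm{H}=\frac{1}{\sqrt2}\begin{pmatrix}1&1\\1&-1\end{pmatrix}$, the Phase gate $\mathrm{P}=\mathrm{diag}(1,i)$ and the controlled-NOT gate $\mathrm{CNOT}$, acting on any qubit (resp. any ordered pair of distinct qubits). Also $\mathrm{CZ}=\mathrm{diag}(1,1,1,-1)$ is the controlled-$Z$ gate. An -H- (resp. -P-, -C-, -CZ-) layer is any unitary computable by a circuit consisting only of $\mathrm{H}$ (resp. $\mathrm{P}$, $\mathrm{CNOT}$, $\mathrm{CZ}$) gates, acting on any qubits or pairs of qubits, the identity being allowed. A layered expression denotes circuits obtained by performing, in order from left to right, one layer of each indicated type. In the Linear Nearest Neighbor (LNN) architecture the qubits $1,\dots,n$ are arranged on a line and a two-qubit gate may act only on neighboring qubits $j,j+1$ (either one may be the control). The two-qubit gate depth of a circuit is the number of layers of two-qubit gates, where gates within a layer act on pairwise disjoint qubits; single-qubit gates may be interleaved freely between these layers and are not counted. *)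

(* Defs.v *)
From HB Require Import structures.
From mathcomp Require Import all_boot all_order all_algebra.

Set Implicit Arguments.
Unset Strict Implicit.
Unset Printing Implicit Defensive.

Import Order.TTheory GRing.Theory Num.Theory.
Local Open Scope ring_scope.

Inductive gate (n : nat) : Type :=
  | gateH of 'I_n
  | gateP of 'I_n
  | gateCNOT (c t : 'I_n) of c != t
  | gateCZ (a b : 'I_n) of a != b.

(* The head of the sequence is the gate applied first. *)
Definition circuit (n : nat) : Type := seq (gate n).

Section Predicates.
Variable n : nat.
Implicit Types (g : gate n) (s : circuit n).

Definition isH g := if g is gateH _ then true else false.
Definition isP g := if g is gateP _ then true else false.
Definition isCNOT g := if g is gateCNOT _ _ _ then true else false.
Definition isCZ g := if g is gateCZ _ _ _ then true else false.

Definition stabilizer_gate g := [|| isH g, isP g | isCNOT g].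
Definition single_qubit g := isH g || isP g.

Definition gate_support g : {set 'I_n} :=
  match g with
  | gateH j | gateP j => [set j]
  | gateCNOT a b _ | gateCZ a b _ => [set a; b]
  end.

Definition nearest_neighbor g : bool :=
  match g with
  | gateH _ | gateP _ => true
  | gateCNOT a b _ | gateCZ a b _ => (a.+1 == b :> nat) || (b.+1 == a :> nat)
  end.

Definition two_qubit_layer s : bool :=
  all (fun g => ~~ single_qubit g) s
  && pairwise (fun g h => [disjoint gate_support g & gate_support h]) s.

(* [has_depth s d]: s is presented with d layers of two-qubit gates, with      *)
(* arbitrary single-qubit gates before, between and after them. Layers may be  *)
(* empty, so only upper bounds on d are meaningful.                            *)
Inductive has_depth : circuit n -> nat -> Prop :=
  | HasDepth0 s : all single_qubit s -> has_depth s 0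
  | HasDepthS s l s' d : all single_qubit s -> two_qubit_layer l ->
      has_depth s' d -> has_depth (s ++ l ++ s') d.+1.

End Predicates.

(* Computational basis vectors |x> are indexed by x : {ffun 'I_n -> 'I_2}; an  *)
(* n-qubit operator is a square matrix of size #|{ffun 'I_n -> 'I_2}| = 2 ^ n  *)
(* whose row and column indices stand for such x through [bits].               *)
(* C is any algebraically closed field with conjugation, e.g. R[i].            *)
Notation operator C n := ('M[C]_#|{ffun 'I_n -> 'I_2}|).

Definition bits (n : nat) (x : 'I_#|{ffun 'I_n -> 'I_2}|) :
  {ffun 'I_n -> 'I_2} := enum_val x.

Section Semantics.
Variables (C : numClosedFieldType) (n : nat).

Definition mxH : 'M[C]_2 := (sqrtC 2)^-1 *: \matrix_(i, j) (-1) ^+ (i * j)%N.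
Definition mxP : 'M[C]_2 := \matrix_(i, j) ('i ^+ i *+ (i == j)).
Definition mxX : 'M[C]_2 := \matrix_(i, j) (i != j)%:R.
Definition mxZ : 'M[C]_2 := \matrix_(i, j) ((-1) ^+ i *+ (i == j)).
Definition mxY : 'M[C]_2 := 'i *: (mxX *m mxZ).

(* A 0 (x) A 1 (x) ... (x) A (n - 1) *)
Definition tensor (A : 'I_n -> 'M[C]_2) : operator C n :=
  \matrix_(x, y) \prod_k A k (bits x k) (bits y k).

Definition on_qubit (j : 'I_n) (A : 'M[C]_2) : operator C n :=
  tensor (fun k => if k == j then A else 1%:M).

(* |y> |-> |y'> with y'_t = y_t + y_c mod 2 and y'_k = y_k for k != t *)
Definition cnot_op (c t : 'I_n) : operator C n :=
  \matrix_(x, y)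
    (bits x == [ffun k => if k == t then bits y t + bits y c
                          else bits y k])%:R.

(* |x> |-> (-1) ^ (x_a x_b) |x> *)
Definition cz_op (a b : 'I_n) : operator C n :=
  \matrix_(x, y) ((-1) ^+ (bits x a * bits x b)%N *+ (x == y)).

Definition gate_op (g : gate n) : operator C n :=
  match g with
  | gateH j => on_qubit j mxH
  | gateP j => on_qubit j mxP
  | gateCNOT c t _ => cnot_op c t
  | gateCZ a b _ => cz_op a b
  end.

Fixpoint circuit_op (s : circuit n) : operator C n :=
  if s is g :: s' then circuit_op s' *m gate_op g else 1%:M.

(* Phases of the Pauli group are left out: they are global phases. *)
Definition is_pauli (Q : operator C n) : Prop :=
  exists2 A : 'I_n -> 'M[C]_2,
    forall k, A k \in [:: 1%:M; mxX; mxY; mxZ] & Q = tensor A.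

Definition is_layer (p : pred (gate n)) (U : operator C n) : Prop :=
  exists2 s : circuit n, all p s & U = circuit_op s.

(* The layer of the first type in ps is performed first. *)
Fixpoint is_layered (ps : seq (pred (gate n))) (U : operator C n) : Prop :=
  if ps is p :: ps' then
    exists L V, [/\ is_layer p L, is_layered ps' V & U = V *m L]
  else U = 1%:M.

End Semantics.

Arguments isH {n} g.
Arguments isP {n} g.
Arguments isCNOT {n} g.
Arguments isCZ {n} g.
Arguments stabilizer_gate {n} g.
Arguments nearest_neighbor {n} g.
Arguments circuit_op C {n} s.

(* Main.v *)
Require Import Defs.
From mathcomp Require Import all_boot all_order all_algebra.
From mathcomp Require Import ring zify.

(* Conjugation by a circuit acts on Pauli operators, up to phase, as a         *)
(* symplectic transformation over F_2. By Schur's lemma two circuits with the  *)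
(* same action differ by a Pauli operator and a scalar; that scalar has        *)
(* modulus 1 and lies in Z[zeta, 1 / sqrt 2] with zeta = exp (i pi / 4), hence *)
(* is a power of zeta, which single-qubit gates can produce. Both claims thus  *)
(* only concern symplectic actions.                                            *)
(*                                                                             *)
(* Normal form: by row and column operations (the outer CNOT layers) the       *)
(* images of the Z_j become X_j * (Z's) for j < r and Z_j for j >= r. These    *)
(* Z's form a symmetric matrix, removed by CZ and P gates; Hadamard gates on   *)
(* the first r qubits then restore every Z_j, and a second symmetric matrix    *)
(* is removed from the images of the X_j.                                      *)
(*                                                                             *)
(* Nearest neighbor depth: the images of Z_q and X_q are brought back to Z_q   *)
(* and X_q for q = 0, 1, ... by sweeps of two-qubit boxes of CNOT depth at     *)
(* most 2, each running from qubit n - 1 down to q. The 2 n sweeps can be      *)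
(* pipelined, for a total depth of 10 n <= 14 n - 4.                           *)

(** One invariant drives both constructions. Circuits preserve the commutation form [sform] of Pauli
    operators ([act_sform]), and pairing with Z_k or X_k reads off the exponents at qubit k
    ([sformZ], [sformX]). Commutation relations thus do the work of linear algebra: they show that
    images are nontrivial, that the matrices to be cleared are symmetric, and that qubits already
    treated stay untouched.

    [gate_conj] links gates to their action on tableaux. [circuit_op_of_act] turns equality of
    actions into equality of operators up to a power of zeta and a Pauli operator, by way of
    [pauli_of_commute] and [unit_cyclotomic8]. The layered form tolerates this defect, and
    [normal_form_act] supplies its circuit. The nearest neighbor claim is an exact equality:
    [lnn_act] supplies a circuit with the right action, and [single_qubit_fix] absorbs the defect
    into single-qubit gates, which cost no depth. Depth is first estimated qubit by qubit ([sched]);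
    [sched_layers] then converts the estimate into actual layers. *)

Set Implicit Arguments.
Unset Strict Implicit.
Unset Printing Implicit Defensive.

Import Order.TTheory GRing.Theory Num.Theory.
Local Open Scope ring_scope.

(** * Symplectic action of circuits *)

(* A Pauli operator up to phase: [v k] is the pair of exponents of X and Z at k. *)
Notation pauli n := {ffun 'I_n -> bool * bool}.

Section Tableau.
Variable n : nat.
Implicit Types (g : gate n) (s : circuit n) (v w : pauli n) (j k : 'I_n).

Definition gate_act g v : pauli n :=
  match g with
  | gateH j => [ffun k => if k == j then ((v k).2, (v k).1) else v k]
  | gateP j => [ffun k => if k == j then ((v k).1, (v k).2 (+) (v k).1) else v k]
  | gateCNOT c t _ =>
      [ffun k => if k == c then ((v c).1, (v c).2 (+) (v t).2)
                 else if k == t then ((v t).1 (+) (v c).1, (v t).2) else v k]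
  | gateCZ a b _ =>
      [ffun k => if k == a then ((v a).1, (v a).2 (+) (v b).1)
                 else if k == b then ((v b).1, (v b).2 (+) (v a).1) else v k]
  end.

Definition act s v := foldl (fun w g => gate_act g w) v s.

Lemma act_cat s s' v : act (s ++ s') v = act s' (act s v).
Proof. exact: foldl_cat. Qed.

Lemma act_rcons s g v : act (rcons s g) v = gate_act g (act s v).
Proof. exact: foldl_rcons. Qed.

(** This holds for P as well: P ^ 2 = Z is a Pauli operator, and conjugation by it only changes
    signs. Hence a reversed circuit acts as the inverse. *)
Lemma gate_actK g : involutive (gate_act g).
Proof.
case: g => [j|j|c t ct|a b ab] v; apply/ffunP => k; rewrite !ffunE.
- by case: eqP => // ->; case: (v j).
- by case: eqP => // ->; case: (v j) => -[] [].
- rewrite !eqxx (eq_sym t) (negbTE ct).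
  case: eqP => [->|_]; first by case: (v c) (v t) => [[] []] [[] []].
  by case: eqP => // ->; case: (v c) (v t) => [[] []] [[] []].
- rewrite !eqxx (eq_sym b) (negbTE ab).
  case: eqP => [->|_]; first by case: (v a) (v b) => [[] []] [[] []].
  by case: eqP => // ->; case: (v a) (v b) => [[] []] [[] []].
Qed.

Lemma act_rev s v : act (rev s) (act s v) = v.
Proof.
elim: s v => //= g s IHs v.
by rewrite rev_cons act_rcons IHs gate_actK.
Qed.

Lemma act_revK s v : act s (act (rev s) v) = v.
Proof. by rewrite -{1}(revK s) act_rev. Qed.

Definition pauli_add v w : pauli n :=
  [ffun k => ((v k).1 (+) (w k).1, (v k).2 (+) (w k).2)].

Lemma act_add s v w : act s (pauli_add v w) = pauli_add (act s v) (act s w).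
Proof.
elim: s v w => //= g s IHs v w; rewrite -IHs; congr (act s _).
case: g => [j|j|c t ct|a b ab]; apply/ffunP => k; rewrite !ffunE;
  repeat case: eqP => //= _; congr pair; exact: addbACA.
Qed.

Lemma gate_act_out g v k : k \notin gate_support g -> gate_act g v k = v k.
Proof.
by case: g => [j|j|c t ct|a b ab]; rewrite /= !inE ?ffunE ?negb_or;
  [move/negbTE-> | move/negbTE-> | case/andP=> /negbTE-> /negbTE->..].
Qed.

Lemma act_out s v k :
  all (fun g => k \notin gate_support g) s -> act s v k = v k.
Proof.
by elim: s v => //= g s IHs v /andP[kg /IHs->]; rewrite gate_act_out.
Qed.

(** With [gate_act_out], this makes gates with disjoint supports commute, which is what lets them be
    rescheduled. *)
Lemma gate_act_local g v w :
  {in gate_support g, v =1 w} -> {in gate_support g, gate_act g v =1 gate_act g w}.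
Proof.
by case: g => [j|j|c t ct|a b ab] vw k kg; rewrite !ffunE ?vw //=
  ?inE ?eqxx ?orbT.
Qed.

Lemma gate_act_commute g h v :
    [disjoint gate_support g & gate_support h] ->
  gate_act g (gate_act h v) = gate_act h (gate_act g v).
Proof.
move=> gh; apply/ffunP => k.
have [kg|kg] := boolP (k \in gate_support g).
  have kh : k \notin gate_support h by rewrite (disjointFr gh).
  rewrite [RHS]gate_act_out //; apply: gate_act_local (kg) => i ig.
  by rewrite gate_act_out // (disjointFr gh).
rewrite gate_act_out //.
have [kh|kh] := boolP (k \in gate_support h); last by rewrite !gate_act_out.
apply: gate_act_local (kh) => i ih.
by rewrite gate_act_out // (disjointFl gh).
Qed.

(** The symplectic form over F_2: true exactly when the two Pauli operators anticommute. *)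
Definition sform v w : bool :=
  \big[addb/false]_k (((v k).1 && (w k).2) (+) ((v k).2 && (w k).1)).

Lemma gate_sform g v w : sform (gate_act g v) (gate_act g w) = sform v w.
Proof.
(* Outside its support a gate changes neither Pauli operator, so only the terms at a and b need to
   be compared. *)
have two_qubit a b :
    a != b -> (forall k, k \notin [set a; b] ->
      gate_act g v k = v k /\ gate_act g w k = w k) ->
    (let f v w k := ((v k).1 && (w k).2) (+) ((v k).2 && (w k).1) in
     f (gate_act g v) (gate_act g w) a (+) f (gate_act g v) (gate_act g w) b
     = f v w a (+) f v w b) ->
    sform (gate_act g v) (gate_act g w) = sform v w.
  move=> ab out /= eq_ab; have ba : b != a by rewrite eq_sym.
  rewrite /sform ![\big[_/_]_k _](bigD1 a) //= !(bigD1 b ba) /=.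
  rewrite [LHS]addbA [RHS]addbA eq_ab.
  congr (_ (+) _); apply: eq_bigr => k /andP[ka kb].
  by have [|-> ->] := out k; rewrite // !inE negb_or ka kb.
case: g two_qubit => [j _|j _|c t ct|a b ab].
- apply: eq_bigr => k _; rewrite !ffunE; case: eqP => //= _.
  by case: (v k) (w k) => [[] []] [[] []].
- apply: eq_bigr => k _; rewrite !ffunE; case: eqP => //= _.
  by case: (v k) (w k) => [[] []] [[] []].
- move=> /(_ c t ct); apply=> [k kct|f].
    by rewrite !gate_act_out.
  rewrite /f /= !ffunE !eqxx (eq_sym t) (negbTE ct).
  by case: (v c) (v t) (w c) (w t) => [[] []] [[] []] [[] []] [[] []].
- move=> /(_ a b ab); apply=> [k kab|f].
    by rewrite !gate_act_out.
  rewrite /f /= !ffunE !eqxx (eq_sym b) (negbTE ab).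
  by case: (v a) (v b) (w a) (w b) => [[] []] [[] []] [[] []] [[] []].
Qed.

Lemma act_sform s v w : sform (act s v) (act s w) = sform v w.
Proof. by elim: s v w => //= g s IHs v w; rewrite IHs gate_sform. Qed.

Definition pauliZ j : pauli n := [ffun k => (false, k == j)].
Definition pauliX j : pauli n := [ffun k => (k == j, false)].

Lemma sformZ j v : sform (pauliZ j) v = (v j).1.
Proof.
rewrite /sform (bigD1 j) //= big1 => [|k /negbTE kj]; rewrite !ffunE ?kj //=.
by rewrite eqxx !addbF.
Qed.

Lemma sformX j v : sform (pauliX j) v = (v j).2.
Proof.
rewrite /sform (bigD1 j) //= big1 => [|k /negbTE kj]; rewrite !ffunE ?kj //=.
by rewrite eqxx !addbF.
Qed.

(* Nondegeneracy of the symplectic form replaces an argument by linearity. *)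
Lemma act_id s : (forall j, act s (pauliZ j) = pauliZ j) ->
  (forall j, act s (pauliX j) = pauliX j) -> act s =1 id.
Proof.
move=> sZ sX v; apply/ffunP => k; rewrite [LHS]surjective_pairing.
rewrite -sformZ -sformX -{1}(sZ k) -(sX k) !act_sform sformZ sformX.
by case: (v k).
Qed.

End Tableau.

(** * Pauli operators and Schur's lemma *)

Lemma ord2P (P : 'I_2 -> Prop) : P 0 -> P 1 -> forall i, P i.
Proof.
move=> P0 P1 [[|[|//]] lt_i2].
  by rewrite (_ : Ordinal _ = 0) //; apply: val_inj.
by rewrite (_ : Ordinal _ = 1) //; apply: val_inj.
Qed.

Section Operators.
Variables (C : numClosedFieldType) (n : nat).
Local Notation T := {ffun 'I_n -> 'I_2}.
Implicit Types (j k : 'I_n) (v w : pauli n) (a b : T).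
Implicit Types (U V : operator C n).

Lemma ffun_neq a b : a != b -> exists k, a k != b k.
Proof.
move=> ab; apply/existsP; apply: contraR ab; rewrite negb_exists => /forallP e.
by apply/eqP/ffunP => k; apply/eqP; move/negPn: (e k).
Qed.

Lemma bits_inj : injective (@bits n).
Proof. exact: enum_val_inj. Qed.

Lemma sum_bits (F : T -> C) : \sum_x F (bits x) = \sum_a F a.
Proof.
rewrite (reindex (@enum_rank T)) /=; first by under eq_bigr do rewrite /bits enum_rankK.
by exists (@bits n) => x _; rewrite /bits ?enum_valK ?enum_rankK.
Qed.

Lemma mul_tensor (A B : 'I_n -> 'M[C]_2) :
  tensor A *m tensor B = tensor (fun k => A k *m B k).
Proof.
apply/matrixP => x y; rewrite !mxE.
transitivity (\sum_z \prod_k (A k (bits x k) (bits z k) * B k (bits z k) (bits y k))).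
  by apply: eq_bigr => z _; rewrite !mxE big_split.
rewrite (sum_bits (fun a => \prod_k (A k (bits x k) (a k) * B k (a k) (bits y k)))).
rewrite -(bigA_distr_bigA (fun k i => A k (bits x k) i * B k i (bits y k))) /=.
by apply: eq_bigr => k _; rewrite mxE.
Qed.

Lemma eq_tensor (A B : 'I_n -> 'M[C]_2) : A =1 B -> tensor A = tensor B.
Proof.
by move=> AB; apply/matrixP => x y; rewrite !mxE; apply: eq_bigr => k _; rewrite AB.
Qed.

Lemma tensor1 : tensor (fun=> 1%:M) = 1%:M :> operator C n.
Proof.
apply/matrixP => x y; rewrite !mxE -(inj_eq bits_inj).
under eq_bigr do rewrite mxE.
have [->|xy] := eqVneq; first by rewrite big1 // => k _; rewrite eqxx.
have [k xyk] := ffun_neq xy.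
by rewrite (bigD1 k) //= (negbTE xyk) mul0r.
Qed.

Lemma tensorZ (c : 'I_n -> C) (A : 'I_n -> 'M[C]_2) :
  tensor (fun k => c k *: A k) = (\prod_k c k) *: tensor A.
Proof.
apply/matrixP => x y; rewrite !mxE -big_split /=.
by apply: eq_bigr => k _; rewrite mxE.
Qed.

Lemma mul_on_qubit j (A B : 'M[C]_2) :
  on_qubit j A *m on_qubit j B = on_qubit j (A *m B).
Proof.
rewrite mul_tensor; apply: eq_tensor => k.
by case: eqP => // _; rewrite mul1mx.
Qed.

Lemma scale_tensor j c (A : 'I_n -> 'M[C]_2) :
  c *: tensor A = tensor (fun k => if k == j then c *: A k else A k).
Proof.
rewrite -[c in LHS](_ : \prod_k (if k == j then c else 1) = c).
  by rewrite -tensorZ; apply: eq_tensor => k; case: eqP => // _; rewrite scale1r.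
by rewrite (bigD1 j) //= eqxx big1 ?mulr1 // => k /negbTE->.
Qed.

Lemma on_qubitZ j c (A : 'M[C]_2) : on_qubit j (c *: A) = c *: on_qubit j A.
Proof. by rewrite (scale_tensor j); apply: eq_tensor => k; case: eqP. Qed.

Lemma on_qubit1 j : on_qubit j 1%:M = 1%:M :> operator C n.
Proof. by rewrite -tensor1; apply: eq_tensor => k; case: eqP. Qed.

Definition bit (b : bool) : 'I_2 := if b then 1 else 0.

(** This is X ^ p.1 Z ^ p.2; in particular (true, true) stands for XZ = - i Y. *)
Definition pauli_mx (p : bool * bool) : 'M[C]_2 :=
  \matrix_(i, j) ((i == j + bit p.1)%:R * (-1) ^+ (p.2 * j)%N).

Definition pauli_op v : operator C n := tensor (fun k => pauli_mx (v k)).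

Lemma ord2_addK (i j : 'I_2) : i + j + j = i.
Proof. by elim/ord2P: i; elim/ord2P: j; apply: val_inj. Qed.

Lemma ffun2_addK a b : a + b + b = a.
Proof. by apply/ffunP => k; rewrite !ffunE ord2_addK. Qed.

Lemma ffun2_add_eq a b d : (a + d == b) = (a == b + d).
Proof. by apply/eqP/eqP => [<-|->]; rewrite ffun2_addK. Qed.

Definition xbits v : T := [ffun k => bit (v k).1].
Definition zsign v a : C := \prod_k (-1) ^+ ((v k).2 * a k)%N.

Lemma pauli_opE v x y :
  pauli_op v x y = (bits x == bits y + xbits v)%:R * zsign v (bits y).
Proof.
rewrite mxE; under eq_bigr do rewrite mxE.
rewrite big_split /= -/(zsign v _); congr (_ * _).
have [e|xy] := eqVneq (bits x).
  by rewrite e big1 // => k _; rewrite !ffunE eqxx.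
have [k xyk] := ffun_neq xy.
by move: xyk; rewrite !ffunE => xyk; rewrite (bigD1 k) //= (negbTE xyk) mul0r.
Qed.

Definition entry (U : operator C n) a b : C := U (enum_rank a) (enum_rank b).

Lemma entryE U x y : U x y = entry U (bits x) (bits y).
Proof. by rewrite /entry !enum_valK. Qed.

Lemma entry_eq U V : (forall a b, entry U a b = entry V a b) -> U = V.
Proof. by move=> UV; apply/matrixP => x y; rewrite !entryE. Qed.

Lemma entryZ c U a b : entry (c *: U) a b = c * entry U a b.
Proof. by rewrite /entry mxE. Qed.

Lemma entry_mul U V a b :
  entry (U *m V) a b = \sum_d entry U a d * entry V d b.
Proof.
rewrite {1}/entry mxE -[RHS]sum_bits.
by apply: eq_bigr => x _; rewrite /entry !enum_valK.
Qed.

Lemma entry_pauli v a b :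
  entry (pauli_op v) a b = (a == b + xbits v)%:R * zsign v b.
Proof. by rewrite /entry pauli_opE /bits !enum_rankK. Qed.

Lemma entry_mul_pauli U v a b :
  entry (U *m pauli_op v) a b = entry U a (b + xbits v) * zsign v b.
Proof.
rewrite entry_mul (bigD1 (b + xbits v)) //= big1 ?addr0.
  by rewrite entry_pauli eqxx mul1r.
by move=> d db; rewrite entry_pauli (negbTE db) mul0r mulr0.
Qed.

Lemma entry_pauli_mul U v a b :
  entry (pauli_op v *m U) a b = zsign v (a + xbits v) * entry U (a + xbits v) b.
Proof.
rewrite entry_mul (bigD1 (a + xbits v)) //= big1 ?addr0.
  by rewrite entry_pauli ffun2_addK eqxx mul1r.
by move=> d da; rewrite entry_pauli -ffun2_add_eq eq_sym (negbTE da) !mul0r.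
Qed.

Lemma zsignX v a : (forall k, (v k).2 = false) -> zsign v a = 1.
Proof. by move=> v0; rewrite /zsign big1 // => k _; rewrite v0 mul0n. Qed.

Lemma zsignZ j a : zsign (pauliZ j) a = (-1) ^+ a j.
Proof.
rewrite /zsign (bigD1 j) //= big1 => [|k /negbTE kj]; rewrite !ffunE ?kj //=.
by rewrite eqxx mul1n mulr1.
Qed.

Lemma xbitsZ j : xbits (pauliZ j) = 0.
Proof. by apply/ffunP => k; rewrite !ffunE. Qed.

Lemma sign_ord2_inj (i j : 'I_2) : (-1) ^+ i = (-1) ^+ j :> C -> i = j.
Proof.
have N1 : (-1 == 1 :> C) = false by rewrite eqNr oner_eq0.
elim/ord2P: i; elim/ord2P: j => //=; rewrite expr0 expr1 => /eqP.
  by rewrite eq_sym N1.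
by rewrite N1.
Qed.

Lemma sign_ord2D (i j : 'I_2) : (-1) ^+ (i + j)%R = (-1) ^+ i * (-1) ^+ j :> C.
Proof.
by elim/ord2P: i; elim/ord2P: j; rewrite /= ?expr0 ?expr1 ?mulr1 ?mul1r ?mulrNN ?mulr1.
Qed.

(* Schur's lemma for projective commutation. *)
Lemma pauli_of_commute U : U != 0 ->
    (forall v, exists c, U *m pauli_op v = c *: (pauli_op v *m U)) ->
  exists c w, U = c *: pauli_op w.
Proof.
move=> U0 comm.
have {}comm v : exists c, forall a b,
    entry U a (b + xbits v) * zsign v b =
    c * (zsign v (a + xbits v) * entry U (a + xbits v) b).
  have [c e] := comm v; exists c => a b.
  by rewrite -entry_mul_pauli e entryZ entry_pauli_mul.
have [a0 [b0 ab0]] : exists a b, entry U a b != 0.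
  have /existsP[a /existsP[b ab]] : [exists a, exists b, entry U a b != 0].
    apply: contraR U0; rewrite negb_exists => /forallP e.
    apply/eqP/entry_eq => a b; move: (e a); rewrite negb_exists.
    by move=> /forallP/(_ b)/negPn/eqP->; rewrite /entry mxE.
  by exists a, b.
pose d := a0 + b0.
(* Commutation with Z_j makes (-1) ^ (a_j + b_j) constant on the support of U, so U is a bit shift
   by d composed with a diagonal matrix D. *)
have suppU a b : entry U a b != 0 -> a = b + d.
  move=> ab; suff <- : a + b = d by rewrite addrC ffun2_addK.
  apply/ffunP => j; have [c e] := comm (pauliZ j).
  have sgnD a' b' : entry U a' b' != 0 -> (-1) ^+ (a' j + b' j)%R = c.
    move=> ab'; rewrite sign_ord2D.
    suff -> : (-1) ^+ b' j = c * (-1) ^+ a' j.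
      by rewrite mulrCA -expr2 sqrr_sign mulr1.
    move: (e a' b'); rewrite xbitsZ !addr0 !zsignZ mulrA [RHS]mulrC.
    by move/(mulfI ab').
  by apply: sign_ord2_inj; rewrite !ffunE (sgnD _ _ ab) (sgnD _ _ ab0).
pose D b := entry U (b + d) b.
(* Commutation with products of X's: translating the argument of D multiplies D by a constant. *)
have shift h : exists c, forall b, D (b + h) = c * D b.
  pose v : pauli n := [ffun k => (h k == 1, false)].
  have xv : xbits v = h.
    by apply/ffunP => k; rewrite !ffunE /=; elim/ord2P: (h k).
  have [c e] := comm v; exists c => b; have := e (b + d + h) b.
  rewrite xv !zsignX ?mulr1 ?mul1r ?ffun2_addK; try by move=> k; rewrite ffunE.
  by rewrite /D addrAC.
have Db0 : D b0 != 0 by rewrite /D addrC /d ffun2_addK.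
have D0 : D 0 != 0.
  have [c e] := shift b0; apply: contraNneq Db0 => D0.
  by have := e 0; rewrite add0r D0 mulr0 => ->.
pose delta k : T := [ffun i => if i == k then 1 else 0].
pose w : pauli n := [ffun k => (d k == 1, D (delta k) != D 0)].
(* Translating twice by delta k is the identity, so the constant is a sign, recorded as the Z
   exponent of w at k. *)
have shift_delta k b : D (b + delta k) = (-1) ^+ (w k).2 * D b.
  have [c e] := shift (delta k).
  have /(mulIf D0) sqc : c * c * D 0 = 1 * D 0.
    by rewrite -mulrA -e -e ffun2_addK mul1r.
  rewrite e ffunE /= -[delta k]add0r e; congr (_ * _).
  move/eqP: sqc; rewrite -expr2 sqrf_eq1 => /orP[] /eqP->.
    by rewrite mul1r eqxx.
  rewrite mulN1r (_ : (- D 0 == D 0) = false) //.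
  by rewrite eqNr (negbTE D0).
(* The bits of b are switched on one qubit at a time. *)
have Dsign b : D b = D 0 * zsign w b.
  pose part (r : seq 'I_n) : T := [ffun k => if k \in r then b k else 0].
  have {1}-> : b = part (enum 'I_n).
    by apply/ffunP => k; rewrite ffunE mem_enum.
  rewrite /zsign -big_enum /=.
  elim: (enum _) (enum_uniq 'I_n) => [_|k r IHr /andP[kr /IHr{}IHr]].
    by rewrite big_nil mulr1; congr D; apply/ffunP => k; rewrite !ffunE.
  rewrite big_cons mulrCA -IHr.
  have := erefl (b k); move: {2}(b k); elim/ord2P => bk; rewrite bk.
    rewrite muln0 mul1r; congr D; apply/ffunP => i; rewrite !ffunE inE.
    by case: eqP => // ->; rewrite bk if_same.
  rewrite muln1 -shift_delta; congr D; apply/ffunP => i; rewrite !ffunE inE.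
  by case: eqP => [->|_]; rewrite ?(negbTE kr) ?bk ?addr0 ?add0r.
exists (D 0), w; apply: entry_eq => a b; rewrite entryZ entry_pauli.
have -> : xbits w = d.
  by apply/ffunP => k; rewrite ffunE [w k]ffunE; elim/ord2P: (d k).
have [->|/eqP abd] := eqVneq a (b + d); first by rewrite mul1r -Dsign.
rewrite mul0r mulr0; apply/eqP; apply: contra_notT abd; exact: suppU.
Qed.

End Operators.

(** * Conjugation of Pauli operators by gates, inverse circuits and determinants *)

Lemma mx2P (R : pzSemiRingType) (A B : 'M[R]_2) :
  A 0 0 = B 0 0 -> A 0 1 = B 0 1 -> A 1 0 = B 1 0 -> A 1 1 = B 1 1 -> A = B.
Proof.
by move=> *; apply/matrixP => i j; elim/ord2P: i; elim/ord2P: j.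
Qed.

Lemma mulmx2E (R : pzSemiRingType) (A B : 'M[R]_2) i j :
  (A *m B) i j = A i 0 * B 0 j + A i 1 * B 1 j.
Proof.
rewrite mxE !big_ord_recl big_ord0 addr0.
by congr (_ + A i _ * B _ j); apply: val_inj.
Qed.

Section Conjugation.
Variables (C : numClosedFieldType) (n : nat).
Implicit Types (j k : 'I_n) (v w : pauli n) (g : gate n) (s : circuit n).

Lemma on_qubit_conj j c p (A : 'M[C]_2) v :
    A *m pauli_mx C (v j) = c *: (pauli_mx C p *m A) ->
  on_qubit j A *m pauli_op C v =
  c *: (pauli_op C [ffun k => if k == j then p else v k] *m on_qubit j A).
Proof.
move=> e; rewrite !mul_tensor (scale_tensor j); apply: eq_tensor => k.
by rewrite ffunE; case: eqP => [->|_]; rewrite ?mul1mx ?mulmx1.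
Qed.

(** The Hadamard matrix without its factor 1 / sqrt 2, so that its entries are integers. *)
Definition mxH0 : 'M[C]_2 := \matrix_(i, j) (-1) ^+ (i * j)%N.

Lemma mxHE : mxH C = (sqrtC 2)^-1 *: mxH0. Proof. by []. Qed.

Lemma mxH_conj p : exists c,
  mxH C *m pauli_mx C p = c *: (pauli_mx C (p.2, p.1) *m mxH C).
Proof.
exists (if p.1 && p.2 then -1 else 1).
rewrite mxHE -scalemxAl -scalemxAr scalerA mulrC -scalerA; congr (_ *: _).
case: p => [[] []]; apply: mx2P; rewrite [RHS]mxE !mulmx2E !mxE /=
  ?expr0 ?expr1 ?mulr0 ?mul0r ?mulr1 ?mul1r ?addr0 ?add0r ?mulrNN ?mulrN1 ?mulN1r; ring.
Qed.

Lemma mxP_conj p : exists c,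
  mxP C *m pauli_mx C p = c *: (pauli_mx C (p.1, p.2 (+) p.1) *m mxP C).
Proof.
exists (if p.1 then 'i else 1).
case: p => [[] []]; apply: mx2P; rewrite [RHS]mxE !mulmx2E !mxE /=
  ?expr0 ?expr1 ?mulr0n ?mulr1n; try ring.
all: rewrite !(mul0r, mul1r, add0r, mulr0, addr0, mulr1, mulrN1, mulNr, mulN1r).
all: by rewrite ?mulrN -expr2 sqrCi ?opprK.
Qed.

Definition cnot_bits (c t : 'I_n) (b : {ffun 'I_n -> 'I_2}) : {ffun 'I_n -> 'I_2} :=
  [ffun k => if k == t then b t + b c else b k].

Lemma cnot_bitsK c t : c != t -> involutive (cnot_bits c t).
Proof.
move=> /negbTE ct b; apply/ffunP => k; rewrite !ffunE eqxx ct.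
by case: eqP => // ->; rewrite ord2_addK.
Qed.

Lemma cnot_bitsD c t a b : cnot_bits c t (a + b) = cnot_bits c t a + cnot_bits c t b.
Proof. by apply/ffunP => k; rewrite !ffunE; case: eqP => // _; rewrite addrACA. Qed.

Lemma entry_cnot c t a b : entry (cnot_op C c t) a b = (a == cnot_bits c t b)%:R.
Proof. by rewrite /entry mxE /bits !enum_rankK. Qed.

Lemma entry_cnot_mul c t U a b : c != t ->
  entry (cnot_op C c t *m U) a b = entry U (cnot_bits c t a) b.
Proof.
move=> ct; rewrite entry_mul (bigD1 (cnot_bits c t a)) //= big1 ?addr0.
  by rewrite entry_cnot cnot_bitsK // eqxx mul1r.
move=> d da; rewrite entry_cnot -{1}(cnot_bitsK ct a).
by rewrite (inj_eq (inv_inj (cnot_bitsK ct))) eq_sym (negbTE da) mul0r.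
Qed.

Lemma entry_mul_cnot c t U a b :
  entry (U *m cnot_op C c t) a b = entry U a (cnot_bits c t b).
Proof.
rewrite entry_mul (bigD1 (cnot_bits c t b)) //= big1 ?addr0.
  by rewrite entry_cnot eqxx mulr1.
by move=> d db; rewrite entry_cnot (negbTE db) mulr0.
Qed.

Definition cz_sign (i j : 'I_n) (b : {ffun 'I_n -> 'I_2}) : C := (-1) ^+ (b i * b j)%N.

Lemma entry_cz i j a b : entry (cz_op C i j) a b = cz_sign i j a *+ (a == b).
Proof. by rewrite /entry mxE /bits !enum_rankK (inj_eq enum_rank_inj). Qed.

Lemma entry_cz_mul i j U a b :
  entry (cz_op C i j *m U) a b = cz_sign i j a * entry U a b.
Proof.
rewrite entry_mul (bigD1 a) //= big1 ?addr0.
  by rewrite entry_cz eqxx.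
by move=> d da; rewrite entry_cz eq_sym (negbTE da) mul0r.
Qed.

Lemma entry_mul_cz i j U a b :
  entry (U *m cz_op C i j) a b = entry U a b * cz_sign i j b.
Proof.
rewrite entry_mul (bigD1 b) //= big1 ?addr0.
  by rewrite entry_cz eqxx.
by move=> d db; rewrite entry_cz (negbTE db) mulr0.
Qed.

Lemma gate_conj g v : exists c,
  gate_op C g *m pauli_op C v = c *: (pauli_op C (gate_act g v) *m gate_op C g).
Proof.
case: g => [j|j|i j ij|i j ij] /=.
- by have [c e] := mxH_conj (v j); exists c; rewrite (on_qubit_conj e);
     congr (_ *: (pauli_op C _ *m _)); apply/ffunP => k; rewrite !ffunE;
     case: eqP => // ->.
- by have [c e] := mxP_conj (v j); exists c; rewrite (on_qubit_conj e);
     congr (_ *: (pauli_op C _ *m _)); apply/ffunP => k; rewrite !ffunE;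
     case: eqP => // ->.
(* CNOT permutes basis vectors linearly, so no phase appears and the entries can be compared after a
   change of basis vector. *)
- exists 1; rewrite scale1r; apply: entry_eq => a b.
  rewrite entry_cnot_mul // entry_mul_cnot !entry_pauli.
  rewrite -(inj_eq (inv_inj (cnot_bitsK ij))) cnot_bitsK // cnot_bitsD.
  have ji : j != i by rewrite eq_sym.
  congr ((_ == _ + _)%:R * _).
    apply/ffunP => k; rewrite !ffunE.
    case: (eqVneq k j) => [->|_]; first rewrite (negbTE ji).
      by case: (v i) (v j) => [[] []] [[] []]; apply: val_inj.
    by case: eqP => // ->.
  rewrite /zsign ![\prod_k _](bigD1 i) //= !(bigD1 j ji) /= ![LHS]mulrA ![RHS]mulrA.
  congr (_ * _); last first.
    by apply: eq_bigr => k /andP[/negbTE ki /negbTE kj]; rewrite !ffunE ki kj.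
  rewrite !ffunE !eqxx (negbTE ij) (negbTE ji).
  move: (b i) (b j) => bi bj; elim/ord2P: bi; elim/ord2P: bj;
    by case: (v i) (v j) => [[] []] [[] []]; rewrite /= ?expr0 ?expr1; ring.
(* X_i becomes X_i Z_j and X_j becomes Z_i X_j; when both occur, moving Z_j past X_j costs a
   sign. *)
- exists (if (v i).1 && (v j).1 then -1 else 1); apply: entry_eq => a b.
  have ji : j != i by rewrite eq_sym.
  rewrite entry_cz_mul entryZ entry_mul_cz !entry_pauli.
  have -> : xbits (gate_act (gateCZ ij) v) = xbits v.
    apply/ffunP => k; rewrite !ffunE.
    by case: (eqVneq k i) => [->//|_]; case: eqP => // ->.
  case: eqP => [->|_]; last by rewrite !(mul0r, mulr0).
  have zsE u : zsign C u b = (-1) ^+ ((u i).2 * b i)%N * ((-1) ^+ ((u j).2 * b j)%N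
      * \prod_(k | (k != i) && (k != j)) (-1) ^+ ((u k).2 * b k)%N).
    by rewrite /zsign (bigD1 i) //= (bigD1 j ji).
  rewrite !zsE; set rest := \prod_(k | _) _; set rest' := \prod_(k | _) _.
  have -> : rest' = rest.
    by apply: eq_bigr => k /andP[/negbTE ki /negbTE kj]; rewrite !ffunE ki kj.
  rewrite /cz_sign !ffunE !eqxx (negbTE ji).
  move: (b i) (b j) rest => bi bj rest; elim/ord2P: bi; elim/ord2P: bj;
    by case: (v i) (v j) => [[] []] [[] []]; rewrite /= ?expr0 ?expr1; ring.
Qed.

(** P has order 4 and the other gates square to 1. A common exponent gives inverses within the gate
    set and determinants that are roots of unity. *)
Lemma gate_op4 g :
  gate_op C g *m gate_op C g *m (gate_op C g *m gate_op C g) = 1%:M.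
Proof.
have sq1 (U : operator C n) : U *m U = 1%:M -> U *m U *m (U *m U) = 1%:M.
  by move=> ->; rewrite mulmx1.
case: g => [j|j|i j ij|i j ij] /=.
- apply: sq1; rewrite mul_on_qubit -(on_qubit1 C j); congr on_qubit.
  rewrite mxHE -scalemxAl -scalemxAr scalerA -invfM -expr2 sqrtCK.
  apply: (scalerI (a := 2)); rewrite ?pnatr_eq0 // scalerA divff ?pnatr_eq0 // scale1r.
  by apply: mx2P; rewrite [RHS]mxE mulmx2E !mxE /= ?expr0 ?expr1; ring.
- rewrite !mul_on_qubit -(on_qubit1 C j); congr on_qubit.
  have ii : 'i * 'i = -1 :> C by rewrite -expr2 sqrCi.
  by apply: mx2P; rewrite !mulmx2E !mxE /= ?mulr0n ?mulr1n ?expr0 ?expr1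
    ?(mul0r, mul1r, add0r, mulr0, addr0, mulr1) // ii mulrNN mulr1.
- apply: sq1; apply: entry_eq => a b.
  rewrite entry_cnot_mul // entry_cnot (inj_eq (inv_inj (cnot_bitsK ij))).
  by rewrite /entry mxE (inj_eq enum_rank_inj).
- apply: sq1; apply: entry_eq => a b.
  rewrite entry_cz_mul entry_cz /entry mxE (inj_eq enum_rank_inj).
  by rewrite mulrnAr -expr2 sqrr_sign.
Qed.

Lemma circuit_op_cat s s' : circuit_op C (s ++ s') = circuit_op C s' *m circuit_op C s.
Proof. by elim: s => [|g s IHs] /=; rewrite ?mulmx1 // IHs mulmxA. Qed.

Lemma circuit_op_conj s v : exists c,
  circuit_op C s *m pauli_op C v = c *: (pauli_op C (act s v) *m circuit_op C s).
Proof.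
elim: s v => [|g s IHs] v /=; first by exists 1; rewrite mulmx1 mul1mx scale1r.
have [c e] := gate_conj g v; have [c' e'] := IHs (gate_act g v).
exists (c * c').
by rewrite -mulmxA e -scalemxAr (mulmxA (circuit_op C s)) e' -scalemxAl scalerA mulmxA.
Qed.

(* Every gate has order dividing 4. *)
Fixpoint inv_circuit s : circuit n :=
  if s is g :: s' then inv_circuit s' ++ [:: g; g; g] else [::].

Lemma inv_circuit_op s : circuit_op C (inv_circuit s) *m circuit_op C s = 1%:M.
Proof.
elim: s => [|g s IHs] /=; first by rewrite mulmx1.
rewrite circuit_op_cat /= mul1mx -mulmxA (mulmxA (circuit_op C (inv_circuit s))).
by rewrite IHs mul1mx -mulmxA gate_op4.
Qed.

Lemma inv_circuit_act s v : act (inv_circuit s) (act s v) = v.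
Proof. by elim: s v => //= g s IHs v; rewrite act_cat IHs /= !gate_actK. Qed.

Lemma norm_det_gate g : `|\det (gate_op C g)| = 1.
Proof.
apply/eqP; rewrite -(@pexpr_eq1 _ _ 4) // -normrX.
have -> : \det (gate_op C g) ^+ 4 = 1.
  by rewrite -(det1 C #|{ffun 'I_n -> 'I_2}|) -(gate_op4 g) !det_mulmx; ring.
by rewrite normr1.
Qed.

Lemma norm_det_circuit s : `|\det (circuit_op C s)| = 1.
Proof.
elim: s => [|g s IHs] /=; first by rewrite det1 normr1.
by rewrite det_mulmx normrM IHs norm_det_gate mulr1.
Qed.

Lemma norm_scalar_circuit s c : circuit_op C s = c%:M -> `|c| = 1.
Proof.
move=> e; have := norm_det_circuit s; rewrite e det_scalar normrX => /eqP.
by rewrite pexpr_eq1 ?card_ffun ?card_ord ?expn_gt0 // => /eqP.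
Qed.

End Conjugation.

(** * Scalars in the Clifford group *)

Section CyclotomicIntegers.
Variable C : numClosedFieldType.
Local Notation r2 := (sqrtC 2 : C).

Definition zeta8 : C := (1 + 'i) / r2.

Definition cyclotomic8 (z : C) : Prop := exists a b c d : int,
  z = a%:~R + b%:~R * zeta8 + c%:~R * zeta8 ^+ 2 + d%:~R * zeta8 ^+ 3.

Lemma sqrtC2_neq0 : r2 != 0.
Proof. by rewrite sqrtC_eq0 pnatr_eq0. Qed.

Lemma zeta8_2 : zeta8 ^+ 2 = 'i.
Proof.
rewrite expr_div_n sqrtCK.
have -> : (1 + 'i) ^+ 2 = 2 * 'i + (1 + 'i ^+ 2) :> C by ring.
by rewrite sqrCi subrr addr0 mulrC mulKf // pnatr_eq0.
Qed.

Lemma zeta8_4 : zeta8 ^+ 4 = -1.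
Proof. by rewrite (exprM _ 2 2) zeta8_2 sqrCi. Qed.

Lemma zeta8_8 : zeta8 ^+ 8 = 1.
Proof. by rewrite (exprM _ 4 2) zeta8_4 sqrrN expr1n. Qed.

Lemma norm_zeta8 : `|zeta8| = 1.
Proof. by apply/eqP; rewrite -(@pexpr_eq1 _ _ 8) // -normrX zeta8_8 normr1. Qed.

Lemma zeta8_r2 : zeta8 - zeta8 ^+ 3 = r2.
Proof.
rewrite (exprD _ 2 1) zeta8_2 expr1 /zeta8.
have -> : (1 + 'i) / r2 - 'i * ((1 + 'i) / r2) = (1 - 'i ^+ 2) / r2 by ring.
rewrite sqrCi opprK -[1 + 1]sqrtCK expr2 mulfK //; exact: sqrtC2_neq0.
Qed.

Lemma conj_zeta8 : zeta8^* = - zeta8 ^+ 3.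
Proof.
have r2c : r2^* = r2 by apply: conj_Creal; apply: ger0_real; rewrite sqrtC_ge0 ler0n.
rewrite (exprD _ 2 1) zeta8_2 expr1 /zeta8 rmorphM rmorphD rmorph1 /= conjCi.
rewrite fmorphV /= r2c.
rewrite mulrA -mulNr; congr (_ / _); rewrite mulrDr mulr1 -expr2 sqrCi; ring.
Qed.

Lemma cyclotomic8_int (m : int) : cyclotomic8 m%:~R.
Proof. by exists m, 0, 0, 0; ring. Qed.

Lemma cyclotomic8_zeta8 : cyclotomic8 zeta8.
Proof. by exists 0, 1, 0, 0; ring. Qed.

Lemma cyclotomic8D x y : cyclotomic8 x -> cyclotomic8 y -> cyclotomic8 (x + y).
Proof.
move=> [a [b [c [d ->]]]] [a' [b' [c' [d' ->]]]].
by exists (a + a'), (b + b'), (c + c'), (d + d'); ring.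
Qed.

Lemma cyclotomic8M x y : cyclotomic8 x -> cyclotomic8 y -> cyclotomic8 (x * y).
Proof.
move=> [a [b [c [d ->]]]] [a' [b' [c' [d' ->]]]].
exists (a * a' - b * d' - c * c' - d * b'), (a * b' + b * a' - c * d' - d * c'),
  (a * c' + b * b' + c * a' - d * d'), (a * d' + b * c' + c * b' + d * a').
apply/eqP; rewrite -subr_eq0; apply/eqP; set z := zeta8.
(* The second factor is the quotient by z ^ 4 + 1 of the difference of the two sides, seen as
   polynomials in z. *)
transitivity ((z ^+ 4 - -1) * ((b * d' + c * c' + d * b')%:~R
  + (c * d' + d * c')%:~R * z + (d * d')%:~R * z ^+ 2)).
  by ring.
by rewrite zeta8_4 subrr mul0r.
Qed.

Lemma cyclotomic8X x m : cyclotomic8 x -> cyclotomic8 (x ^+ m).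
Proof.
move=> Zx; elim: m => [|m IHm]; first by rewrite expr0; exact: (cyclotomic8_int 1).
by rewrite exprS; apply: cyclotomic8M.
Qed.

Lemma cyclotomic8_sign m : cyclotomic8 ((-1) ^+ m).
Proof. exact/cyclotomic8X/(cyclotomic8_int (-1)). Qed.

Lemma cyclotomic8_nat m : cyclotomic8 m%:R.
Proof. exact: (cyclotomic8_int m). Qed.

Lemma int_sqrt2 (p q : int) : p%:~R + q%:~R * r2 = 0 -> p = 0 /\ q = 0.
Proof.
move=> e0; have e : p ^+ 2 = 2 * q ^+ 2.
  apply/eqP; rewrite -(eqr_int C) intrM !rmorphXn /=; apply/eqP.
  have -> : p%:~R = - (q%:~R * r2) by apply/eqP; rewrite -addr_eq0 e0 eqxx.
  by rewrite sqrrN exprMn sqrtCK mulrC.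
have {}e : (`|p| ^ 2 = 2 * `|q| ^ 2)%N by rewrite -!abszX e abszM.
suff q0 : q = 0.
  split=> //; move: e; rewrite q0 absz0 exp0n // muln0 => /eqP.
  by rewrite expn_eq0 andbT absz_eq0 => /eqP.
have [/eqP|q_gt0] := posnP `|q|; first by rewrite absz_eq0 => /eqP.
(* The exponent of 2 is even on the left and odd on the right. *)
have := congr1 (logn 2) e.
rewrite lognX lognM ?expn_gt0 ?q_gt0 // lognX (_ : logn 2 2 = 1%N) //; lia.
Qed.

Lemma norm_cyclotomic8 (a b c d : int) :
  `|a%:~R + b%:~R * zeta8 + c%:~R * zeta8 ^+ 2 + d%:~R * zeta8 ^+ 3| ^+ 2 =
  (a ^+ 2 + b ^+ 2 + c ^+ 2 + d ^+ 2)%:~R + (a * b + b * c + c * d - d * a)%:~R * r2.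
Proof.
rewrite normCK -zeta8_r2.
move: zeta8 conj_zeta8 zeta8_4 => t conj_t t4.
rewrite !rmorphD !rmorphM /= !conj_t !rmorph_int.
apply/eqP; rewrite -subr_eq0; apply/eqP.
(* With conj t = - t ^ 3 and sqrt 2 = t - t ^ 3 both sides are polynomials in t; the second factor
   is the quotient of their difference by t ^ 4 + 1. *)
transitivity ((t ^+ 4 - -1) * (- (b ^+ 2 + c ^+ 2 + d ^+ 2)%:~R
  - (b * c + c * d - d * a)%:~R * t + (a * c)%:~R * t ^+ 2
  + (b * c + c * d)%:~R * t ^+ 3 + (c ^+ 2 + d ^+ 2)%:~R * t ^+ 4
  + (c * d - d * a)%:~R * t ^+ 5 - (b * d)%:~R * t ^+ 6
  - (c * d)%:~R * t ^+ 7 - (d ^+ 2)%:~R * t ^+ 8)).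
  by ring.
by rewrite t4 subrr mul0r.
Qed.

(* Comparing rational and irrational parts of |z|^2 shows that an element of  *)
(* Z[zeta8] with |z|^2 = 2 ^ m is divisible by sqrt 2 as soon as m > 0.        *)
Lemma unit_cyclotomic8 (z : C) m :
  cyclotomic8 (z * r2 ^+ m) -> `|z| = 1 -> exists j, z = zeta8 ^+ j.
Proof.
move=> Zz z1; elim: m Zz => [|m IHm] [a [b [c [d e]]]];
  have := norm_cyclotomic8 a b c d; rewrite -e normrM z1 mul1r normrX exprAC;
  rewrite [`|r2|]ger0_norm ?sqrtC_ge0 ?ler0n // sqrtCK -natrX => /esym/eqP;
  rewrite -subr_eq0 addrAC pmulrn -rmorphB /= => /eqP/int_sqrt2[/eqP];
  rewrite subr_eq0 => /eqP S2 T0.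
  (* Case m = 0: the four squares sum to 1, so one coefficient is 1 or -1 and the others vanish. *)
  have sqr_eq1 (x : int) : x ^+ 2 = 1 -> x = 1 \/ x = -1 by nia.
  have {S2} : [\/ [/\ a ^+ 2 = 1, b = 0, c = 0 & d = 0],
      [/\ b ^+ 2 = 1, a = 0, c = 0 & d = 0],
      [/\ c ^+ 2 = 1, a = 0, b = 0 & d = 0] | [/\ d ^+ 2 = 1, a = 0, b = 0 & c = 0]].
    have sq0 (x : int) : x = 0 \/ 1 <= x ^+ 2 by nia.
    have [a0|a1] := sq0 a; last by constructor 1; split; nia.
    have [b0|b1] := sq0 b; last by constructor 2; split; nia.
    have [c0|c1] := sq0 c; last by constructor 3; split; nia.
    by constructor 4; split; nia.
  have exN (x : int) k y : x ^+ 2 = 1 -> y = x%:~R * zeta8 ^+ k ->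
      exists j, y = zeta8 ^+ j.
    move=> /sqr_eq1[->|->] ->; first by exists k; rewrite mul1r.
    by exists (4 + k)%N; rewrite exprD zeta8_4.
  rewrite expr0 mulr1 in e.
  by case=> [] [x2 h1 h2 h3]; [apply: (exN a 0%N) | apply: (exN b 1%N)
      | apply: (exN c 2%N) | apply: (exN d 3%N)];
    rewrite // e h1 h2 h3; ring.
have half (x : int) : exists k, x = 2 * k \/ x = 2 * k + 1.
  by exists (x %/ 2)%Z; lia.
(* Modulo 2 the sum of squares is (a + c) + (b + d), and the coefficient of sqrt 2 is (a + c) (b +
   d). Both are even, hence so are a + c and b + d. *)
have [] : (exists k, a + c = 2 * k) /\ (exists l, b + d = 2 * l).
  move: S2 T0; rewrite expnS PoszM.
  have [ka [->|->]] := half a; have [kb [->|->]] := half b; have [kc [->|->]] := half c;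
    have [kd [->|->]] := half d => S2 T0;
    first [lia | split; [exists (ka + kc); lia | exists (kb + kd); lia]
      | split; [exists (ka + kc); lia | exists (kb + kd + 1); lia]
      | split; [exists (ka + kc + 1); lia | exists (kb + kd); lia]
      | split; [exists (ka + kc + 1); lia | exists (kb + kd + 1); lia]].
move=> [k ak] [l bl].
(* The quotient by sqrt 2 is half the product with zeta - zeta ^ 3; its coefficients are (b - d) /
   2, (a + c) / 2, (b + d) / 2 and (c - a) / 2. *)
apply: IHm; exists (b - l), k, l, (c - k).
apply: (mulIf sqrtC2_neq0); rewrite -mulrA -exprSr e.
have -> : a = 2 * k - c by lia.
have -> : d = 2 * l - b by lia.
rewrite -zeta8_r2; apply/eqP; rewrite -subr_eq0; apply/eqP.
transitivity ((zeta8 ^+ 4 - -1) *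
  ((2 * k - c)%:~R + l%:~R * zeta8 + (c - k)%:~R * zeta8 ^+ 2)); first by ring.
by rewrite zeta8_4 subrr mul0r.
Qed.
End CyclotomicIntegers.

(** * From equal actions to equal operators *)

Section CircuitPhase.
Variables (C : numClosedFieldType) (n : nat).
Implicit Types (j k : 'I_n) (v w : pauli n) (g : gate n) (s : circuit n).

Lemma cyclotomic8_sum (I : Type) (r : seq I) (F : I -> C) :
  (forall i, cyclotomic8 (F i)) -> cyclotomic8 (\sum_(i <- r) F i).
Proof.
move=> ZF; apply: (big_ind (@cyclotomic8 C)) => [|x y|i _] //.
  exact: (cyclotomic8_int _ 0).
exact: cyclotomic8D.
Qed.

Lemma cyclotomic8_tensor (A : 'I_n -> 'M[C]_2) x y :
  (forall k a b, cyclotomic8 (A k a b)) -> cyclotomic8 (tensor A x y).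
Proof.
move=> ZA; rewrite mxE; apply: (big_ind (@cyclotomic8 C)) => [|z t|k _] //.
  exact: (cyclotomic8_nat _ 1).
exact: cyclotomic8M.
Qed.

Lemma cyclotomic8_on_qubit j (A : 'M[C]_2) x y :
  (forall a b, cyclotomic8 (A a b)) -> cyclotomic8 (on_qubit j A x y).
Proof.
move=> ZA; apply: cyclotomic8_tensor => k a b.
by case: eqP => // _; rewrite mxE; exact: cyclotomic8_nat.
Qed.

(** A power of sqrt 2 clears the denominators; H alone requires one. *)
Lemma cyclotomic8_gate g :
  exists m, forall x y, cyclotomic8 (sqrtC 2 ^+ m * gate_op C g x y).
Proof.
case: g => [j|j|c t ct|a b ab].
- exists 1%N => x y.
  have -> : sqrtC 2 ^+ 1 * gate_op C (gateH j) x y = on_qubit j (mxH0 C) x y.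
    by rewrite /= mxHE on_qubitZ mxE expr1 mulrA divff ?sqrtC2_neq0 // mul1r.
  by apply: cyclotomic8_on_qubit => a b; rewrite mxE; exact: cyclotomic8_sign.
- exists 0%N => x y; rewrite expr0 mul1r /=.
  apply: cyclotomic8_on_qubit => a b; rewrite mxE -mulr_natr.
  apply: cyclotomic8M; last exact: cyclotomic8_nat.
  by rewrite -zeta8_2; do 2!apply: cyclotomic8X; exact: cyclotomic8_zeta8.
- exists 0%N => x y; rewrite expr0 mul1r /= mxE; exact: cyclotomic8_nat.
- exists 0%N => x y; rewrite expr0 mul1r /= mxE -mulr_natr.
  by apply: cyclotomic8M; [exact: cyclotomic8_sign | exact: cyclotomic8_nat].
Qed.

Lemma cyclotomic8_circuit s :
  exists m, forall x y, cyclotomic8 (sqrtC 2 ^+ m * circuit_op C s x y).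
Proof.
elim: s => [|g s [m IHs]] /=.
  by exists 0%N => x y; rewrite expr0 mul1r mxE; exact: cyclotomic8_nat.
have [m' Zg] := cyclotomic8_gate g; exists (m + m')%N => x y.
rewrite mxE mulr_sumr; apply: cyclotomic8_sum => z.
by rewrite exprD mulrACA; apply: cyclotomic8M.
Qed.

Lemma scalar_circuit s (c : C) :
  circuit_op C s = c%:M -> exists m, c = zeta8 C ^+ m.
Proof.
move=> e; have [m Zs] := cyclotomic8_circuit s.
apply: (@unit_cyclotomic8 _ _ m); last exact: norm_scalar_circuit e.
pose x := enum_rank (0 : {ffun 'I_n -> 'I_2}).
by have := Zs x x; rewrite e mxE eqxx mulr1n mulrC.
Qed.

(** Z = P ^ 2 and X = H Z H. *)
Definition pauli_circuit1 j (p : bool * bool) : circuit n :=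
  (if p.2 then [:: gateP j; gateP j] else [::]) ++
  (if p.1 then [:: gateH j; gateP j; gateP j; gateH j] else [::]).

Lemma pauli_circuit1_op j p :
  circuit_op C (pauli_circuit1 j p) = on_qubit j (pauli_mx C p).
Proof.
have PP : mxP C *m mxP C = pauli_mx C (false, true).
  by apply: mx2P; rewrite mulmx2E !mxE /= ?mulr0n ?mulr1n ?expr0 ?expr1
    ?(mul0r, mul1r, add0r, mulr0, addr0, mulr1) // -expr2 sqrCi.
have HZH : mxH C *m pauli_mx C (false, true) *m mxH C = pauli_mx C (true, false).
  rewrite mxHE -scalemxAl -scalemxAl -scalemxAr scalerA -invfM -expr2 sqrtCK.
  apply: (scalerI (a := 2)); rewrite ?pnatr_eq0 // scalerA divff ?pnatr_eq0 // scale1r.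
  by apply: mx2P; rewrite [RHS]mxE !mulmx2E !mxE /= ?expr0 ?expr1; ring.
rewrite circuit_op_cat.
case: p => [[] []] /=; rewrite ?mul1mx ?mulmx1 ?mul_on_qubit ?PP.
- rewrite -[_ *m mxP C *m mxP C]mulmxA PP HZH; congr on_qubit.
  by apply: mx2P; rewrite mulmx2E !mxE /= ?expr0 ?expr1; ring.
- by rewrite -[_ *m mxP C *m mxP C]mulmxA PP HZH.
- by [].
by rewrite -(on_qubit1 C j); congr on_qubit; apply: mx2P;
  rewrite !mxE /= ?expr0 ?expr1; ring.
Qed.

Definition pauli_circuit w : circuit n :=
  flatten [seq pauli_circuit1 j (w j) | j <- enum 'I_n].

Lemma pauli_circuit_op w : circuit_op C (pauli_circuit w) = pauli_op C w.
Proof.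
rewrite /pauli_circuit; transitivity
  (tensor (fun k => if k \in enum 'I_n then pauli_mx C (w k) else 1%:M)); last first.
  by apply: eq_tensor => k; rewrite mem_enum.
elim: (enum _) (enum_uniq 'I_n) => [_|j r IHr /= /andP[jr /IHr{}IHr]] /=.
  by rewrite -(tensor1 C n); apply: eq_tensor.
rewrite circuit_op_cat IHr pauli_circuit1_op mul_tensor; apply: eq_tensor => k.
rewrite inE; case: eqP => [->|_] /=; last by rewrite mulmx1.
by rewrite (negbTE jr) mul1mx.
Qed.

Definition phase_circuit j m : circuit n :=
  flatten (nseq m [:: gateH j; gateP j; gateH j; gateP j; gateH j; gateP j]).

(* (PH)^3 is the scalar exp (i pi / 4). *)
Lemma phase_circuit_op j m : circuit_op C (phase_circuit j m) = (zeta8 C ^+ m)%:M.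
Proof.
have PH3 : mxP C *m mxH C *m mxP C *m mxH C *m mxP C *m mxH C = (zeta8 C)%:M.
  rewrite mxHE; set r := (sqrtC 2)^-1.
  rewrite -?(scalemxAr, scalemxAl).
  (* The three factors 1 / sqrt 2 then leave (1 + i) / sqrt 2. *)
  have -> : mxP C *m mxH0 C *m mxP C *m mxH0 C *m mxP C *m mxH0 C = (2 * (1 + 'i))%:M.
    have i2 : 'i ^+ 2 + 1 = 0 :> C by rewrite sqrCi addNr.
    have eq_i (x y z : C) : x - y = ('i ^+ 2 + 1) * z -> x = y.
      by rewrite i2 mul0r => /eqP; rewrite subr_eq0 => /eqP.
    apply: mx2P; rewrite !mulmx2E !mxE /= ?mulr0n ?mulr1n ?expr0 ?expr1.
    (* For each entry, the last argument of [eq_i] is the quotient of the difference by i ^ 2 +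
       1. *)
    - by apply: (eq_i _ _ (-1)); ring.
    - by apply: (eq_i _ _ 1); ring.
    - by apply: (eq_i _ _ 'i); ring.
    - by apply: (eq_i _ _ (- ('i + 2))); ring.
  rewrite !scale_scalar_mx; congr _%:M.
  have r2 : r * (r * 2) = 1 by rewrite mulrA -invfM -expr2 sqrtCK mulVf ?pnatr_eq0.
  transitivity (r * (r * 2) * ((1 + 'i) * r)); first by ring.
  by rewrite r2 mul1r.
rewrite /phase_circuit; elim: m => [|m IHm] //=.
rewrite IHm -!mulmxA !mul_on_qubit !mulmxA PH3 -[(zeta8 C)%:M]scalemx1.
by rewrite on_qubitZ on_qubit1 -scalemxAr mulmx1 scale_scalar_mx exprS.
Qed.

(** The inverse of s' followed by s fixes every Pauli operator up to a scalar, so Schur's lemma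
    applies to it. *)
Lemma circuit_op_of_act s s' : act s =1 act s' ->
  exists m w, circuit_op C s = zeta8 C ^+ m *: (pauli_op C w *m circuit_op C s').
Proof.
move=> ss'; pose t := inv_circuit s'; pose U := circuit_op C (t ++ s).
have Ut : circuit_op C s = U *m circuit_op C s'.
  by rewrite /U circuit_op_cat -mulmxA inv_circuit_op mulmx1.
have act_id v : act (t ++ s) v = v.
  by rewrite act_cat ss' -{1}(act_revK s' v) inv_circuit_act act_revK.
have [|v|c [w Uw]] := @pauli_of_commute C n U.
- apply/eqP => U0; have := inv_circuit_op C (t ++ s).
  rewrite -/U U0 mulmx0 => /matrixP.
  pose x := enum_rank (0 : {ffun 'I_n -> 'I_2}).
  move=> /(_ x x) /eqP.
  by rewrite !mxE eqxx eq_sym oner_eq0.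
- by have [c e] := circuit_op_conj C (t ++ s) v; exists c; rewrite e act_id.
have [m cm] : exists m, c = zeta8 C ^+ m.
  (* The Pauli factor is itself realized by a circuit; undoing it leaves a circuit whose operator is
     the scalar c. *)
  apply: (@scalar_circuit (t ++ s ++ inv_circuit (pauli_circuit w))).
  rewrite catA circuit_op_cat -/U Uw -scalemxAr -pauli_circuit_op inv_circuit_op.
  by rewrite scalemx1.
by exists m, w; rewrite Ut Uw cm scalemxAl.
Qed.

Lemma single_qubit_fix j s s' : act s =1 act s' ->
  exists2 q, all (@single_qubit n) q & circuit_op C (s' ++ q) = circuit_op C s.
Proof.
move=> /circuit_op_of_act[m [w ->]].
exists (pauli_circuit w ++ phase_circuit j m).
  rewrite all_cat; apply/andP; split.
    rewrite /pauli_circuit; elim: (enum _) => //= k r IHr; rewrite all_cat IHr andbT.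
    by case: (w k) => [[] []].
  by elim: m => //= m IHm.
rewrite !circuit_op_cat phase_circuit_op pauli_circuit_op.
by rewrite -mulmxA mul_scalar_mx.
Qed.

Lemma is_pauli_op w : exists (c : C) (Q : operator C n),
  [/\ `|c| = 1, is_pauli Q & pauli_op C w = c *: Q].
Proof.
pose A k : 'M[C]_2 := match w k with
  | (false, false) => 1%:M | (true, false) => mxX C
  | (false, true) => mxZ C | (true, true) => mxY C end.
pose c k : C := if w k is (true, true) then - 'i else 1.
exists (\prod_k c k), (tensor A); split.
- rewrite normr_prod big1 // => k _.
  by rewrite /c; case: (w k) => [[] []]; rewrite ?normrN ?normCi ?normr1.
- by exists A => // k; rewrite /A !inE; case: (w k) => [[] []]; rewrite eqxx ?orbT.
rewrite -tensorZ; apply: eq_tensor => k; rewrite /A /c.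
case: (w k) => [[] []]; rewrite ?scale1r ?scalerA ?mulNr -?expr2 ?sqrCi ?opprK ?scale1r.
- by apply: mx2P; rewrite mulmx2E !mxE /= ?expr0 ?expr1 ?mulr0n ?mulr1n; ring.
all: by apply: mx2P; rewrite !mxE /= ?expr0 ?expr1 ?mulr0n ?mulr1n; ring.
Qed.

Lemma is_layered_cat (p : pred (gate n)) ps s s' : all p s ->
  is_layered ps (circuit_op C s') -> is_layered (p :: ps) (circuit_op C (s ++ s')).
Proof.
move=> ps_s s'_lay; exists (circuit_op C s), (circuit_op C s').
by split=> //; [exists s | exact: circuit_op_cat].
Qed.

End CircuitPhase.

(** * Scheduling and nearest neighbor elimination *)

Section Scheduling.
Variable n : nat.
Implicit Types (g : gate n) (s : circuit n) (f : 'I_n -> nat).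

(* [sched s f]: in a schedule of [s], [f k] bounds the index of the last      *)
(* two-qubit layer touching or preceding the gates at qubit [k].               *)
Inductive sched : circuit n -> ('I_n -> nat) -> Prop :=
  | SchedNil f : sched [::] f
  | SchedRcons s g f f' : sched s f -> (forall k, f k <= f' k)%N ->
      {in gate_support g &, forall j k, f j + ~~ single_qubit g <= f' k}%N ->
      sched (rcons s g) f'.

Lemma sched_le s f f' : sched s f -> (forall k, f k <= f' k)%N -> sched s f'.
Proof.
case=> [*|{}s g f0 f1 sf le0 le1 le2]; first exact: SchedNil.
apply: SchedRcons sf _ _ => [k|j k jg kg]; first exact: leq_trans (le2 k).
exact: leq_trans (le1 j k jg kg) (le2 k).
Qed.

Lemma sched_single s q f :
  sched s f -> all (@single_qubit n) q -> sched (s ++ q) f.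
Proof.
move=> sf; elim/last_ind: q => [|q g IHq]; first by rewrite cats0.
rewrite all_rcons -rcons_cat => /andP[g1 /IHq sqf].
apply: SchedRcons sqf _ _ => // j k; rewrite g1 addn0.
by case: g g1 => [i|i|//|//] _; rewrite !inE => /eqP-> /eqP->.
Qed.

Lemma sched_cnot s f f' (c t : 'I_n) (ct : c != t) : sched s f ->
    (forall k, f k <= f' k)%N ->
    (f c < f' c)%N -> (f t < f' c)%N -> (f c < f' t)%N -> (f t < f' t)%N ->
  sched (rcons s (gateCNOT ct)) f'.
Proof.
move=> sf ff' *; apply: SchedRcons sf ff' _ => j k /=.
by rewrite addn1 !inE => /orP[] /eqP-> /orP[] /eqP->.
Qed.

Definition disjoint_gate g h := [disjoint gate_support g & gate_support h].

Lemma act_commute g s v : all (disjoint_gate g) s ->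
  act s (gate_act g v) = gate_act g (act s v).
Proof.
elim: s v => //= h s IHs v /andP[gh gs].
by rewrite gate_act_commute 1?disjoint_sym // IHs.
Qed.

(* Layer [t] of two-qubit gates is [B t], and is followed by the single-qubit *)
(* gates [A t].                                                                *)
Fixpoint layers (A B : nat -> circuit n) d : circuit n :=
  if d is d'.+1 then layers A B d' ++ B d ++ A d else A 0.

Definition insert (A : nat -> circuit n) T g t :=
  if t == T then rcons (A t) g else A t.

Lemma all_insert p A T g t :
  all p (insert A T g t) = all p (A t) && ((t == T) ==> p g).
Proof. by rewrite /insert; case: eqP => _; rewrite ?all_rcons ?andbT // andbC. Qed.

Lemma eq_layers A A' B B' d :
    (forall t, t <= d -> A t = A' t)%N -> (forall t, t <= d -> B t = B' t)%N ->
  layers A B d = layers A' B' d.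
Proof.
elim: d => [|d IHd] eA eB /=; first exact: eA.
by rewrite eA // eB // IHd // => t td; [apply: eA | apply: eB]; apply: leqW.
Qed.

(** A gate disjoint from everything after layer T may be moved back from the end of the circuit to
    layer T. *)
Lemma act_insert_single A B T g d v : (T <= d)%N ->
    (forall t, T < t -> all (disjoint_gate g) (A t ++ B t))%N ->
  act (layers (insert A T g) B d) v = gate_act g (act (layers A B d) v).
Proof.
move=> Td dis; elim: d Td => [|d IHd].
  by rewrite leqn0 => /eqP->; rewrite /= /insert eqxx act_rcons.
rewrite leq_eqVlt => /orP[/eqP->|Td] /=; rewrite !act_cat /insert.
  rewrite eqxx act_rcons; congr (gate_act g (act _ (act _ (act _ v)))).
  by apply: eq_layers => // t td; rewrite ifN // neq_ltn ltnS td.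
rewrite gtn_eqF // IHd //; have := dis _ Td; rewrite all_cat => /andP[gA gB].
by rewrite !act_commute.
Qed.

(** The index is a successor because [layers] starts with the single-qubit gates [A 0], with no
    two-qubit layer 0. *)
Lemma act_insert_two A B T g d v : (T < d)%N ->
    (forall t, T < t -> all (disjoint_gate g) (A t))%N ->
    (forall t, T.+1 < t -> all (disjoint_gate g) (B t))%N ->
  act (layers A (insert B T.+1 g) d) v = gate_act g (act (layers A B d) v).
Proof.
move=> Td disA disB; elim: d Td => // d IHd.
rewrite ltnS leq_eqVlt => /orP[/eqP eTd|Td] /=; rewrite !act_cat /insert.
  rewrite -eTd eqxx act_rcons act_commute ?disA //.
  congr (gate_act g (act _ (act _ (act _ v)))).
  by apply: eq_layers => // t td; rewrite ifN // neq_ltn ltnS td.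
by rewrite gtn_eqF ?ltnS // IHd // act_commute ?disB // act_commute ?disA // ltnW.
Qed.

Lemma has_depth_cat_single s d q :
  has_depth s d -> all (@single_qubit n) q -> has_depth (s ++ q) d.
Proof.
move=> + q1; elim=> [s' s1|s' l s'' d' s1 l2 _ IHs].
  by apply: HasDepth0; rewrite all_cat s1.
by rewrite -!catA; apply: HasDepthS.
Qed.

Lemma has_depth_snoc s d l :
  has_depth s d -> two_qubit_layer l -> has_depth (s ++ l) d.+1.
Proof.
move=> + l2; elim=> [s' s1|s' l' s'' d' s1 l2' _ IHs].
  by rewrite -[l]cats0; apply: HasDepthS => //; apply: HasDepth0.
by rewrite -!catA; apply: HasDepthS.
Qed.

Lemma has_depth_layers A B d : (forall t, all (@single_qubit n) (A t)) ->
  (forall t, two_qubit_layer (B t)) -> has_depth (layers A B d) d.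
Proof.
move=> A1 B2; elim: d => [|d IHd] /=; first exact: HasDepth0.
by rewrite catA; apply: has_depth_cat_single => //; apply: has_depth_snoc.
Qed.

Lemma all_layers p A B d : (forall t, all p (A t)) -> (forall t, all p (B t)) ->
  all p (layers A B d).
Proof. by move=> pA pB; elim: d => //= d IHd; rewrite !all_cat IHd pA pB. Qed.

(** Induction along the schedule: each new gate slides back into the layer allotted to it. The
    clause that no gate touches qubit k after layer f k makes the slide legal and keeps the gates of
    a layer disjoint. *)
Lemma sched_layers p s f : sched s f -> all p s -> exists A B,
  [/\ forall t, all (@single_qubit n) (A t), forall t, two_qubit_layer (B t),
      forall t, all p (A t ++ B t),
      forall t k, (f k < t)%N -> all (fun g => k \notin gate_support g) (A t ++ B t)
    & forall d, (forall k, f k <= d)%N -> act (layers A B d) =1 act s].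
Proof.
elim=> [f0 _|{}s g f0 f1 sf IHs le01 le_g].
  exists (fun=> [::]), (fun=> [::]); split=> // d _ v.
  by elim: d => //= d IHd; rewrite cats0.
rewrite all_rcons => /andP[pg /IHs[A [B [A1 B2 pAB free actAB]]]].
have free1 t k : (f1 k < t)%N -> all (fun g => k \notin gate_support g) (A t ++ B t).
  by move=> lt_t; apply: free; apply: leq_ltn_trans lt_t.
have free_g t : (forall k, k \in gate_support g -> (f0 k < t)%N) ->
    all (disjoint_gate g) (A t ++ B t).
  move=> lt_t.
  have : forall k, k \in gate_support g ->
      all (fun h => k \notin gate_support h) (A t ++ B t).
    by move=> k kg; apply/free/lt_t.
  elim: (A t ++ B t) => //= h r IHr gr; apply/andP; split.
    by apply/pred0P => k /=; apply/negbTE/negP => /andP[/gr/andP[/negP hk _] /hk].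
  by apply: IHr => k /gr/andP[].
have [g1|g2] := boolP (single_qubit g).
  have [j gj] : exists j, gate_support g = [set j].
    by case: g g1 {pg le_g free_g} => [j|j|//|//] _; exists j.
  exists (insert A (f1 j) g), B; split=> //.
  - by move=> t; rewrite all_insert A1 g1 implybT.
  - move=> t; have := pAB t; rewrite !all_cat all_insert pg implybT => /andP[-> ->].
    by [].
  - move=> t k lt_t; have := free1 t k lt_t.
    rewrite !all_cat all_insert => /andP[-> ->].
    rewrite andbT; apply/implyP => /eqP et.
    by rewrite gj inE; apply: contraTneq lt_t => ->; rewrite et ltnn.
  - move=> d le_d v; rewrite act_insert_single // ?act_rcons ?actAB //.
      by move=> k; apply: leq_trans (le_d k).
    move=> t lt_t; apply: free_g => k; rewrite gj inE => /eqP->.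
    exact: leq_ltn_trans lt_t.
have [a [b gab]] : exists a b, gate_support g = [set a; b].
  by case: g g2 {pg le_g free_g} => [//|//|a b ?|a b ?] _; exists a, b.
have lt01 j k : j \in [set a; b] -> k \in [set a; b] -> (f0 j < f1 k)%N.
  by rewrite -gab => jg kg; have := le_g j k jg kg; rewrite g2 addn1.
(* This layer exceeds f0 at both qubits, so both are free there, and it respects the bound f1 at
   both. *)
have [T eT] : exists T, T.+1 = minn (f1 a) (f1 b).
  exists (minn (f1 a) (f1 b)).-1; rewrite prednK // leq_min.
  by rewrite !(leq_ltn_trans (leq0n _) (lt01 a _ _ _)) ?inE ?eqxx ?orbT.
have le_T k : k \in gate_support g -> (f0 k < T.+1)%N /\ (T.+1 <= f1 k)%N.
  rewrite gab eT => kab; split; first by rewrite leq_min !lt01 // !inE eqxx ?orbT.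
  by move: kab; rewrite !inE geq_min => /orP[] /eqP->; rewrite leqnn ?orbT.
exists A, (insert B T.+1 g); split=> //.
- move=> t; have := B2 t; rewrite /two_qubit_layer all_insert g2 implybT andbT.
  move=> /andP[-> pB] /=; rewrite /insert; case: eqP pB => // -> pB.
  rewrite pairwise_rcons pB andbT; have := free_g T.+1.
  rewrite all_cat => /(_ _)/andP[k /le_T[] //|_].
  by apply: sub_all => h; rewrite /disjoint_gate disjoint_sym.
- move=> t; have := pAB t; rewrite !all_cat all_insert pg implybT => /andP[-> ->].
  by [].
- move=> t k lt_t; have := free1 t k lt_t.
    rewrite !all_cat all_insert => /andP[-> ->].
  apply/implyP => /eqP et; apply: contraTN lt_t => /le_T[_ le_f1].
  by rewrite -leqNgt et.
- move=> d le_d v; rewrite act_insert_two ?act_rcons ?actAB //.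
  + by move=> k; apply: leq_trans (le_d k).
  + have /le_T[_ le_f1] : a \in gate_support g by rewrite gab !inE eqxx.
    exact: leq_trans le_f1 (le_d a).
  + move=> t lt_t; have := free_g t; rewrite all_cat => /(_ _)/andP[|-> //].
    by move=> k /le_T[lt_f0 _]; apply: leq_trans lt_t.
  + move=> t lt_t; have := free_g t; rewrite all_cat => /(_ _)/andP[|_ -> //].
    by move=> k /le_T[lt_f0 _]; apply: ltn_trans lt_t.
Qed.

Lemma sched_has_depth p s f d : sched s f -> all p s -> (forall k, f k <= d)%N ->
  exists s', [/\ all p s', has_depth s' d & act s' =1 act s].
Proof.
move=> sf ps fd; have [A [B [A1 B2 pAB _ actAB]]] := sched_layers sf ps.
exists (layers A B d); split; last exact: actAB.
  by apply: all_layers => t; have := pAB t; rewrite all_cat => /andP[].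
exact: has_depth_layers.
Qed.

End Scheduling.

(** * Nearest neighbor elimination, one qubit at a time *)

Section Elimination.
Variable n : nat.
Implicit Types (g : gate n) (s b : circuit n) (f : 'I_n -> nat) (v P : pauli n).
Implicit Types (q i j k : 'I_n).

Local Notation pauli1 := (false, false).

Definition local_on (S : pred 'I_n) s : bool :=
  all (fun g => [&& stabilizer_gate g, nearest_neighbor g
                  & [forall k in gate_support g, S k]]) s.

Lemma local_on_cat S s s' : local_on S (s ++ s') = local_on S s && local_on S s'.
Proof. exact: all_cat. Qed.

Lemma sub_local_on (S S' : pred 'I_n) s :
  (forall k, S k -> S' k) -> local_on S s -> local_on S' s.
Proof.
move=> SS'; apply: sub_all => g /and3P[-> -> /forall_inP gS] /=.
by apply/forall_inP => k /gS/SS'.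
Qed.

Lemma local_act_out S s v k : local_on S s -> ~~ S k -> act s v k = v k.
Proof.
move=> sS Sk; apply: act_out; apply: sub_all sS => g /and3P[_ _ /forall_inP gS].
by apply: contra Sk => /gS.
Qed.

Lemma gate_act0 g : gate_act g [ffun=> pauli1] = [ffun=> pauli1].
Proof.
by case: g => [j|j|c t ct|a b ab]; apply/ffunP => k; rewrite !ffunE;
  repeat case: eqP => //= _.
Qed.

Lemma local_act_id (S : pred 'I_n) s v :
  local_on S s -> (forall k, S k -> v k = pauli1) -> act s v = v.
Proof.
move=> + v0; elim: s => //= g s IHs /andP[/and3P[_ _ /forall_inP gS] sS].
suff -> : gate_act g v = v by apply: IHs.
apply/ffunP => k; have [kg|kg] := boolP (k \in gate_support g);
  last exact: gate_act_out.
rewrite (@gate_act_local _ g v [ffun=> pauli1]) ?gate_act0 ?ffunE // => [|i ig].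
  by rewrite v0 // gS.
by rewrite ffunE v0 // gS.
Qed.

Definition to_X j (p : bool * bool) : circuit n :=
  match p with
  | (false, true) => [:: gateH j]
  | (true, true) => [:: gateP j]
  | _ => [::]
  end.

Lemma act_to_X j v : v j != pauli1 ->
  act (to_X j (v j)) v = [ffun k => if k == j then (true, false) else v k].
Proof.
case vj : (v j) => [[] []] //= _; apply/ffunP => k; rewrite !ffunE;
  by case: eqP => // ->; rewrite vj.
Qed.

Lemma to_X_single j p : all (@single_qubit n) (to_X j p).
Proof. by case: p => [[] []]. Qed.

Lemma to_X_local j p (S : pred 'I_n) : S j -> local_on S (to_X j p).
Proof.
move=> Sj; case: p => [[] []] //=; rewrite andbT /=;
  by apply/forall_inP => k; rewrite inE => /eqP->.
Qed.

Lemma single_local j (S : pred 'I_n) :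
  S j -> local_on S [:: gateH j] /\ local_on S [:: gateP j].
Proof.
move=> Sj; split; first exact: (to_X_local (false, true)).
exact: (to_X_local (true, true)).
Qed.

Lemma cnot_local i j (ij : i != j) (S : pred 'I_n) :
  S i -> S j -> j = i.+1 :> nat -> local_on S [:: gateCNOT ij].
Proof.
move=> Si Sj e; rewrite /local_on /nearest_neighbor /= e eqxx andbT /=.
by apply/forall_inP => k; rewrite !inE => /orP[] /eqP->.
Qed.

(* A CNOT gate maps X (x) X to X (x) 1, up to single-qubit gates; if P is      *)
(* trivial at i, a previous CNOT gate spreads its component at j to i.         *)
Lemma box i j P : j = i.+1 :> nat -> exists b,
  [/\ local_on (pred2 i j) b, act b P j = pauli1
    & forall s f, sched s f ->
        sched (s ++ b) (fun k => if pred2 i j k then (maxn (f i) (f j)).+2 else f k)].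
Proof.
move=> e; have ij : i != j by rewrite -(inj_eq val_inj) /= e neq_ltn ltnSn.
have Si : pred2 i j i by rewrite /= eqxx.
have Sj : pred2 i j j by rewrite /= eqxx orbT.
have [[Hi _] [Hj _]] := (single_local Si, single_local Sj).
have Lij := cnot_local ij Si Sj e.
have up f k : (f k <= if pred2 i j k then (maxn (f i) (f j)).+2 else f k)%N.
  by case: ifP => // /orP[] /eqP->; do 2!apply: leqW; rewrite ?leq_maxl ?leq_maxr.
have [Pj0|Pj1] := eqVneq (P j) pauli1.
  exists [::]; split=> // s f sf; rewrite cats0; exact: sched_le sf (up f).
pose f1 f k : nat := if pred2 i j k then (maxn (f i) (f j)).+1 else f k.
have sched1 s f : sched s f -> sched (rcons s (gateCNOT ij)) (f1 f).
  move=> sf; apply: (sched_cnot _ sf) => [k||||];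
    rewrite /f1 ?Si ?Sj ?ltnS ?leq_maxl ?leq_maxr //.
  by case: ifP => // /orP[] /eqP->; apply: leqW; rewrite ?leq_maxl ?leq_maxr.
have le_f1 f k : (f1 f k <= if pred2 i j k then (maxn (f i) (f j)).+2 else f k)%N.
  by rewrite /f1; case: ifP => // _; apply: leqW.
have f11 f k : (f1 (f1 f) k <= if pred2 i j k then (maxn (f i) (f j)).+2 else f k)%N.
  by rewrite /f1 Si Sj maxnn; case: ifP => // ->.
have [Pi0|Pi1] := eqVneq (P i) pauli1.
  (* Successive values at (i, j): 1 (x) X, 1 (x) Z, Z (x) Z, X (x) X, X (x) 1. *)
  exists (to_X j (P j) ++
    [:: gateH j; gateCNOT ij; gateH i; gateH j; gateCNOT ij]); split.
  - rewrite local_on_cat to_X_local //=.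
    by move: Hi Hj Lij => /= /andP[-> _] /andP[-> _] /andP[-> _].
  - rewrite act_cat act_to_X //= !ffunE !eqxx (negbTE ij) eq_sym (negbTE ij) Pi0 /=.
    by [].
  - move=> s f sf; apply: sched_le (f11 f).
    rewrite (_ : s ++ _ =
       rcons (rcons ((s ++ to_X j (P j)) ++ [:: gateH j]) (gateCNOT ij)
       ++ [:: gateH i; gateH j]) (gateCNOT ij)); last by rewrite -!cats1 -!catA.
    apply/sched1/sched_single => //; apply/sched1/sched_single => //.
    exact: (sched_single sf (to_X_single _ _)).
exists (to_X i (P i) ++ to_X j (P j) ++ [:: gateCNOT ij]); split.
- by rewrite !local_on_cat !to_X_local.
- have e1 := act_to_X Pi1; rewrite !act_cat e1.
  set P1 := finfun _; have P1j : P1 j = P j by rewrite ffunE eq_sym (negbTE ij).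
  rewrite -P1j act_to_X ?P1j //= !ffunE !eqxx (negbTE ij) eq_sym (negbTE ij) /=.
  by [].
- move=> s f sf; apply: sched_le (le_f1 f); rewrite !catA cats1; apply: sched1.
  exact: (sched_single (sched_single sf (to_X_single _ _)) (to_X_single _ _)).
Qed.

(* The slope 2 is the depth of a box: successive sweeps running from qubit     *)
(* n - 1 down are pipelined, each costing 4 more layers instead of 2 n.        *)
Definition bounded (c : nat) f := forall k, (f k <= c + 2 * (n - k))%N.

(** A sweep down to q + 1 leaves nothing beyond q + 1, and one box on q and q + 1 then clears q + 1.
    Keeping separate time bounds below, at and above q is what makes the induction and the
    pipelining work. *)
Lemma sweep q P : exists b,
  [/\ local_on (fun k => q <= k)%N b, forall k, (q < k)%N -> act b P k = pauli1
    & forall c s f, sched s f -> bounded c f -> exists f',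
      [/\ sched (s ++ b) f', forall k, (k < q)%N -> (f' k <= c + 2 * (n - k))%N,
          (f' q <= (c + 2 * (n - q)).+2)%N
        & forall k, (q < k)%N -> (f' k <= c + 4 + 2 * (n - k))%N]].
Proof.
have [m mq] : exists m, (n - q)%N = m by exists (n - q)%N.
elim: m q mq P => [|m IHm] q mq P.
  by move/eqP: mq; rewrite subn_eq0 leqNgt ltn_ord.
have [qn|nq] := ltnP q.+1 n; last first.
  exists [::]; split=> // [k qk|c s f sf fc].
    by have := ltn_ord k; rewrite ltnNge (leq_trans nq).
  exists f; split=> [|k _||k qk]; first by rewrite cats0.
  - exact: fc.
  - by have := fc q; lia.
  - by have := fc k; lia.
pose q' : 'I_n := Ordinal qn.
have [|b0 [b0_loc b0P b0_sched]] := IHm q' _ P; first by rewrite /=; lia.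
have [b1 [b1_loc b1P b1_sched]] := @box q q' (act b0 P) erefl.
exists (b0 ++ b1); split.
- rewrite local_on_cat (sub_local_on _ b0_loc) => [|k /ltnW //].
  by apply: sub_local_on b1_loc => k /orP[] /eqP-> //=.
- move=> k qk; rewrite act_cat; have [->//|kq'] := eqVneq k q'.
  have q'k : (q' < k)%N by rewrite ltn_neqAle eq_sym kq'.
  rewrite (local_act_out _ b1_loc) ?b0P //= negb_or kq' andbT.
  by rewrite -(inj_eq val_inj) /= neq_ltn qk orbT.
move=> c s f sf fc; have [f' [sf' lt_f' f'q' gt_f']] := b0_sched c s f sf fc.
exists (fun k => if pred2 q q' k then (maxn (f' q) (f' q')).+2 else f' k).
have f'q : (f' q <= c + 2 * (n - q))%N by apply: lt_f'.
(* Both inputs of the box are ready at c + 2 (n - q): qubit q has waited since the previous sweep,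
   and q' ends its own box at c + 2 (n - q') + 2. The box ends two layers later, at c + 4 + 2 (n -
   q'). *)
have max_le : (maxn (f' q) (f' q') <= c + 2 * (n - q))%N.
  by rewrite geq_max f'q /=; move: f'q' => /=; lia.
split.
- by rewrite catA; apply: b1_sched.
- move=> k kq; rewrite ifN; first by apply: lt_f'; rewrite /= ltnS ltnW.
  by rewrite /= negb_or -!(inj_eq val_inj) /=; lia.
- by rewrite /= eqxx.
- move=> k qk; case: ifP => [/orP[] /eqP ek|/norP[_ kq']].
  + by rewrite ek ltnn in qk.
  + by rewrite ek /=; lia.
  + by apply: gt_f'; rewrite ltn_neqAle eq_sym kq'.
Qed.

Definition fixes m (u : circuit n) := forall j, (j < m)%N ->
  act u (pauliZ j) = pauliZ j /\ act u (pauliX j) = pauliX j.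

Lemma sform0 v w : (forall k, v k = pauli1) -> sform v w = false.
Proof. by move=> v0; apply: big1 => k _; rewrite v0. Qed.

(** The exponents at k are pairings with Z_k and X_k, which t fixes, so invariance of the form
    preserves them. *)
Lemma fixed_support q t v k : fixes q t -> (k < q)%N -> v k = pauli1 ->
  act t v k = pauli1.
Proof.
move=> tq kq v0; rewrite [LHS]surjective_pairing -sformZ -sformX.
by have [<- <-] := tq k kq; rewrite !act_sform sformZ sformX v0.
Qed.

Lemma eliminate_Z q t : fixes q t -> exists b,
  [/\ local_on (fun k => q <= k)%N b, act (t ++ b) (pauliZ q) = pauliZ q
    & forall c s f, sched s f -> bounded c f ->
        exists2 f', sched (s ++ b) f' & bounded (c + 4) f'].
Proof.
move=> tq; pose P := act t (pauliZ q).
have [b0 [b0_loc b0P b0_sched]] := sweep q P; set P1 := act b0 P in b0P.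
have P1k k : k != q -> P1 k = pauli1.
  rewrite -(inj_eq val_inj) neq_ltn => /orP[kq|/b0P//].
  rewrite /P1 (local_act_out _ b0_loc) -?ltnNge //; apply: (fixed_support tq kq).
  by rewrite ffunE -(inj_eq val_inj) (ltn_eqF kq).
(* Otherwise the image of Z_q would be trivial, yet it anticommutes with the image of X_q. *)
have P1q : P1 q != pauli1.
  apply/eqP => P10; have := act_sform (t ++ b0) (pauliZ q) (pauliX q).
  rewrite sformZ ffunE eqxx act_cat sform0 // => k.
  by have [->//|/P1k] := eqVneq k q.
have [Hq _] := @single_local q (fun k => q <= k)%N (leqnn q).
exists (b0 ++ to_X q (P1 q) ++ [:: gateH q]); split.
- by rewrite !local_on_cat b0_loc to_X_local.
- rewrite !act_cat act_to_X //=; apply/ffunP => k; rewrite !ffunE.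
  by case: eqVneq => // /P1k.
move=> c s f sf fc; have [f' [sf' lt_f' f'q gt_f']] := b0_sched c s f sf fc.
exists f'.
  rewrite catA; apply: sched_single sf' _.
  by rewrite all_cat to_X_single.
by move=> k; case: (ltngtP k q) => [/lt_f'|/gt_f'|/val_inj->]; lia.
Qed.

Lemma eliminate_X q t : fixes q t -> act t (pauliZ q) = pauliZ q -> exists b,
  [/\ local_on (fun k => q <= k)%N b, act b (pauliZ q) = pauliZ q,
      act (t ++ b) (pauliX q) = pauliX q
    & forall c s f, sched s f -> bounded c f ->
        exists2 f', sched (s ++ b) f' & bounded (c + 4) f'].
Proof.
move=> tq tZ; pose P := act t (pauliX q).
have Pk k : (k < q)%N -> P k = pauli1.
  move=> kq; apply: (fixed_support tq kq).
  by rewrite ffunE -(inj_eq val_inj) (ltn_eqF kq).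
(* Since Z_q is already restored, the image of X_q anticommutes with Z_q. *)
have Pq : (P q).1 by rewrite -sformZ -tZ act_sform sformZ ffunE eqxx.
pose bP (p : bool * bool) : circuit n := if p.2 then [:: gateP q] else [::].
have [_ Lq] := @single_local q (fun k => q <= k)%N (leqnn q).
have bP_loc p : local_on (fun k => q <= k)%N (bP p) by rewrite /bP; case: ifP.
have bP_single p : all (@single_qubit n) (bP p) by rewrite /bP; case: ifP.
have bPE v : (v q).1 ->
    act (bP (v q)) v = [ffun k => if k == q then (true, false) else v k].
  move=> vq; rewrite /bP; case e : (v q).2; apply/ffunP => k; rewrite !ffunE;
    case: eqP => // ->; move: vq e; by case: (v q) => [[] []].
have bPZ p : act (bP p) (pauliZ q) = pauliZ q.
  rewrite /bP; case: ifP => //= _; apply/ffunP => k; rewrite !ffunE.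
  by case: eqP => // ->; rewrite eqxx.
have [qn|nq] := ltnP q.+1 n; last first.
  exists (bP (P q)); split=> //.
    rewrite act_cat bPE //; apply/ffunP => k; rewrite !ffunE.
    case: eqVneq => // kq; apply: Pk; rewrite ltn_neqAle kq /=.
    by rewrite -ltnS (leq_trans (ltn_ord k)).
  move=> c s f sf fc; exists f; first exact: sched_single.
  by move=> k; rewrite addnAC; apply: leq_trans (fc k) (leq_addr _ _).
pose q' : 'I_n := Ordinal qn.
have qq' : q != q' by rewrite -(inj_eq val_inj) neq_ltn /= ltnSn.
(* The sweep stops at q + 1 so as not to disturb Z_q; a final CNOT with control q, which also fixes
   Z_q, maps X (x) X to X (x) 1. *)
have [b0 [b0_loc b0P b0_sched]] := sweep q' P; set P1 := act b0 P in b0P.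
have P1q : P1 q = P q by rewrite /P1 (local_act_out _ b0_loc) //= ltnn.
have b0Z : act b0 (pauliZ q) = pauliZ q.
  apply: (local_act_id b0_loc) => k q'k; rewrite ffunE.
  by rewrite -(inj_eq val_inj) (gtn_eqF q'k).
have P1k k : k != q -> k != q' -> P1 k = pauli1.
  move=> kq kq'; have [k_lt|] := ltnP k q.
    by rewrite /P1 (local_act_out _ b0_loc) ?Pk // -ltnNge /= ltnW.
  rewrite leq_eqVlt eq_sym (inj_eq val_inj) (negbTE kq) /= => qk.
  by apply: b0P; rewrite ltn_neqAle eq_sym kq'.
pose b1 := if P1 q' == pauli1 then [::]
  else to_X q' (P1 q') ++ [:: gateCNOT qq'].
exists (b0 ++ bP (P1 q) ++ b1).
have q'_loc : (q <= q')%N by rewrite /= leqnSn.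
have b1_loc : local_on (fun k => q <= k)%N b1.
  rewrite /b1; case: eqP => // _; rewrite local_on_cat to_X_local //.
  exact: cnot_local.
split.
- rewrite !local_on_cat bP_loc b1_loc !andbT.
  by apply: sub_local_on b0_loc => k /= /ltnW.
- rewrite !act_cat b0Z bPZ /b1; case: eqP => // _; rewrite act_cat.
  have -> : act (to_X q' (P1 q')) (pauliZ q) = pauliZ q.
    apply: (@local_act_id (pred1 q')) => [|k /eqP->].
      by apply: to_X_local; rewrite /= eqxx.
    by rewrite ffunE eq_sym (negbTE qq').
  apply/ffunP => k; rewrite !ffunE !eqxx [q' == q]eq_sym (negbTE qq').
  by case: eqP => // _; case: eqP.
- rewrite !act_cat -/P -/P1 bPE ?P1q // /b1; set P2 := finfun _.
  have P2q' : P2 q' = P1 q' by rewrite ffunE eq_sym (negbTE qq').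
  case: eqP => [P10|/eqP P11].
    apply/ffunP => k; rewrite !ffunE; case: eqVneq => // kq.
    by have [->|] := eqVneq k q' => // /P1k->.
  rewrite act_cat -P2q' act_to_X ?P2q' //; apply/ffunP => k; rewrite !ffunE.
  rewrite !eqxx (negbTE qq') /=.
  by case: eqVneq => // kq; case: eqVneq => // /P1k->.
move=> c s f sf fc; have [f' [sf' lt_f' f'q' gt_f']] := b0_sched c s f sf fc.
have sf1 := sched_single sf' (bP_single (P1 q)).
have f'q : (f' q <= c + 2 * (n - q))%N by apply: lt_f'.
pose m := (c + 4 + 2 * (n - q'))%N.
exists (fun k => if pred2 q q' k then m else f' k).
  have f'm k : (f' k <= if pred2 q q' k then m else f' k)%N.
    by case: ifP => // /orP[] /eqP->; rewrite /m /=; move: f'q f'q' => /=; lia.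
  rewrite /b1 !catA; case: eqP => _.
    by rewrite cats0; apply: sched_le f'm.
  rewrite catA cats1; apply: (sched_cnot _ (sched_single sf1 (to_X_single _ _))) => //=;
    rewrite ?eqxx ?orbT /m /=; move: f'q f'q' => /=; lia.
move=> k; case: ifP => [/orP[] /eqP->|/norP[kq kq']]; rewrite /m //=.
  by rewrite leq_add2l leq_mul2l leq_sub2l.
have [k_lt|] := ltnP k q'; first by have := lt_f' k k_lt; lia.
by rewrite leq_eqVlt eq_sym (inj_eq val_inj) (negbTE kq') => /gt_f'.
Qed.

Lemma eliminate_qubits t m : (m <= n)%N -> exists b f,
  [/\ all stabilizer_gate b, all nearest_neighbor b, fixes m (t ++ b),
      sched b f & bounded (8 * m) f].
Proof.
elim: m => [_|m IHm mn].
  by exists [::], (fun=> 0%N); split=> //; exact: SchedNil.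
have [b [f [b_stab b_nn b_fix bf fm]]] := IHm (ltnW mn).
pose q : 'I_n := Ordinal mn.
have [b1 [b1_loc b1Z b1_sched]] := @eliminate_Z q _ b_fix.
(* Later gates act on qubits at least m, where Z_j and X_j with j < m are trivial. *)
have keep b' u : local_on (fun k => q <= k)%N b' -> fixes m u -> fixes m (u ++ b').
  move=> b'_loc um j jm; have [uZ uX] := um j jm; rewrite !act_cat uZ uX.
  by split; apply: (local_act_id b'_loc) => k /= mk; rewrite ffunE
    -(inj_eq val_inj) /= (gtn_eqF (leq_trans jm mk)).
have fix1 := keep _ _ b1_loc b_fix.
have [b2 [b2_loc b2Z b2X b2_sched]] := @eliminate_X q _ fix1 b1Z.
have [f1 bf1 fm1] := b1_sched _ _ _ bf fm.
have [f2 bf2 fm2] := b2_sched _ _ _ bf1 fm1.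
have stab_nn S b' : local_on S b' -> all stabilizer_gate b' /\ all nearest_neighbor b'.
  by move=> lb; split; apply: sub_all lb => g /and3P[].
have [b1_stab b1_nn] := stab_nn _ _ b1_loc.
have [b2_stab b2_nn] := stab_nn _ _ b2_loc.
exists ((b ++ b1) ++ b2), f2; split=> //.
- by rewrite !all_cat b_stab b1_stab.
- by rewrite !all_cat b_nn b1_nn.
- rewrite !catA => j; rewrite ltnS leq_eqVlt => /orP[/eqP jm|jm].
    have -> : j = q by apply: val_inj.
    by rewrite b2X act_cat b1Z.
  exact: keep.
- by move=> k; have := fm2 k; rewrite mulnS; lia.
Qed.

Lemma lnn_act s : exists b d,
  [/\ all stabilizer_gate b, all nearest_neighbor b, has_depth b d,
      (d <= 10 * n)%N & act b =1 act s].
Proof.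
(* Eliminating the reversed circuit yields a circuit acting as s itself. Two sweeps of cost 4 per
   qubit and the slope 2 give 8 n + 2 n. *)
have [b [f [b_stab b_nn b_fix bf fn]]] := @eliminate_qubits (rev s) n (leqnn n).
have f_le k : (f k <= 10 * n)%N by have := fn k; lia.
have := @sched_has_depth _ (predI stabilizer_gate nearest_neighbor) _ _ _ bf.
rewrite all_predI b_stab b_nn => /(_ _ isT f_le)[b' [b'_ok b'_d b'b]].
move: b'_ok; rewrite all_predI => /andP[b'_stab b'_nn].
exists b', (10 * n)%N; split=> // v; rewrite b'b.
have := @act_id _ (rev s ++ b) _ _ (act s v).
rewrite act_cat act_rev; apply=> j.
  by have [] := b_fix j (ltn_ord j).
by have [] := b_fix j (ltn_ord j).
Qed.

End Elimination.

(** * Layered normal form *)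

Section Pivoting.
Variable n : nat.
Local Notation bmx := ('I_n -> 'I_n -> bool).
Implicit Types (M : bmx) (a b i j : 'I_n) (k r : nat).

Definition add_row a b M : bmx := fun i j => M i j (+) ((i == b) && M a j).
Definition add_col a b M : bmx := fun i j => M i j (+) ((j == b) && M i a).

(** Operations are confined to indices at least k, so that rows and columns already reduced are
    preserved ([reach_id_below]). *)
Inductive reach k : bmx -> bmx -> Prop :=
  | ReachEq M M' : M =2 M' -> reach k M M'
  | ReachRow a b M M' : a != b -> (k <= a)%N -> (k <= b)%N ->
      reach k (add_row a b M) M' -> reach k M M'
  | ReachCol a b M M' : a != b -> (k <= a)%N -> (k <= b)%N ->
      reach k (add_col a b M) M' -> reach k M M'.

Lemma reach_ext k M1 M2 M' : M1 =2 M2 -> reach k M2 M' -> reach k M1 M'.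
Proof.
move=> + r; elim: r M1 => [{}M2 {}M' e2|a b {}M2 {}M' ab ka kb _ IH
  |a b {}M2 {}M' ab ka kb _ IH] M1 e1.
- by apply: ReachEq => i j; rewrite e1.
- by apply: (ReachRow ab ka kb); apply: IH => i j; rewrite /add_row !e1.
- by apply: (ReachCol ab ka kb); apply: IH => i j; rewrite /add_col !e1.
Qed.

Lemma reach_trans k M1 M2 M3 : reach k M1 M2 -> reach k M2 M3 -> reach k M1 M3.
Proof.
move=> r; elim: r M3 => [{}M1 {}M2 e|a b {}M1 {}M2 ab ka kb _ IH
  |a b {}M1 {}M2 ab ka kb _ IH] M3.
- exact: reach_ext.
- by move/IH; apply: ReachRow.
- by move/IH; apply: ReachCol.
Qed.

Lemma reach_tr k M M' : reach k M M' -> reach k (fun i j => M j i) (fun i j => M' j i).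
Proof.
elim=> [{}M {}M' e|a b {}M {}M' ab ka kb _ IH|a b {}M {}M' ab ka kb _ IH].
- by apply: ReachEq => i j; apply: e.
- exact: (ReachCol ab ka kb).
- exact: (ReachRow ab ka kb).
Qed.

Lemma reach_le k l M M' : (k <= l)%N -> reach l M M' -> reach k M M'.
Proof.
move=> kl; elim=> [{}M {}M' e|a b {}M {}M' ab la lb _ IH|a b {}M {}M' ab la lb _ IH].
- exact: ReachEq.
- exact: (ReachRow ab (leq_trans kl la) (leq_trans kl lb)).
- exact: (ReachCol ab (leq_trans kl la) (leq_trans kl lb)).
Qed.

Definition id_below k M := forall i j, (i < k)%N || (j < k)%N -> M i j = (i == j).

Lemma reach_id_below k M M' : reach k M M' -> id_below k M -> id_below k M'.
Proof.
elim=> [{}M {}M' e|a b {}M {}M' ab ka kb _ IH|a b {}M {}M' ab ka kb _ IH] Mk.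
- by move=> i j ij; rewrite -e Mk.
- apply: IH => i j ij; rewrite /add_row Mk //.
  have [ib|] := eqVneq i b; last by rewrite addbF.
  have jk : (j < k)%N by move: ij; rewrite ib ltnNge kb.
  rewrite Mk ?jk ?orbT // (_ : (a == j) = false) ?addbF //.
  exact: gtn_eqF (leq_trans jk ka).
- apply: IH => i j ij; rewrite /add_col Mk //.
  have [jb|] := eqVneq j b; last by rewrite addbF.
  have ik : (i < k)%N by move: ij; rewrite jb orbC ltnNge kb.
  rewrite Mk ?ik // (_ : (i == a) = false) ?addbF //.
  exact: ltn_eqF (leq_trans ik ka).
Qed.

Lemma clear_column (p : 'I_n) M : M p p ->
  reach p M (fun i j => M i j (+) [&& (p < i)%N, M i p & M p j]).
Proof.
move=> Mp; pose l := [seq i : 'I_n <- enum 'I_n | (p < i)%N].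
have reach_l : reach p M (fun i j => M i j (+) [&& i \in l, M i p & M p j]).
  have : uniq l by rewrite filter_uniq // enum_uniq.
  have : all (fun i => (p < i)%N) l by apply/allP => i; rewrite mem_filter => /andP[].
  elim: l => [_ _|a l IHl /= /andP[pa lp] /andP[al ul]].
    by apply: ReachEq => i j; rewrite addbF.
  apply: reach_trans (IHl lp ul) _.
  have [Ma|Ma] := boolP (M a p); last first.
    apply: ReachEq => i j; rewrite inE.
    by case: eqP => // ->; rewrite (negbTE Ma) (negbTE al) /=.
  have pNa : p != a by rewrite -(inj_eq val_inj) (ltn_eqF pa).
  apply: (ReachRow pNa) => //; first exact: ltnW.
  have pl : (p \in l) = false by apply/negP => /(allP lp); rewrite ltnn.
  apply: ReachEq => i j; rewrite /add_row inE pl /= addbF.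
  by case: eqP => [->|_]; rewrite ?addbF // (negbTE al) Ma /= addbF.
apply: reach_trans reach_l _; apply: ReachEq => i j.
by rewrite mem_filter mem_enum andbT.
Qed.

Lemma clear_cross (p : 'I_n) M : M p p -> id_below p M ->
  exists2 M', reach p M M' & id_below p.+1 M'.
Proof.
move=> Mp Mid; pose M1 i j := M i j (+) [&& (p < i)%N, M i p & M p j].
have r1 : reach p M M1 by apply: clear_column.
have M1id := reach_id_below r1 Mid.
have M1p : M1 p p by rewrite /M1 ltnn addbF.
(* The row of the pivot is cleared as a column of the transpose. *)
have r2 := reach_tr (@clear_column p (fun i j => M1 j i) M1p).
have r := reach_trans r1 r2; apply: (ex_intro2 _ _ _ r).
have M1c i : (p < i)%N -> M1 i p = false by move=> pi; rewrite /M1 pi Mp andbT addbb.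
move=> i j; rewrite !ltnS => ij; have Mij := reach_id_below r Mid.
have [ip|pi] := ltnP i p; first by rewrite Mij ?ip.
have [jp|pj] := ltnP j p; first by rewrite Mij ?jp ?orbT.
move: ij; rewrite [(i <= p)%N]leq_eqVlt [(j <= p)%N]leq_eqVlt !(inj_eq val_inj).
rewrite [(i < p)%N]ltnNge pi [(j < p)%N]ltnNge pj !orbF.
move=> {Mij}; have [-> _|ip] := eqVneq i p.
  move: pj; rewrite leq_eqVlt (inj_eq val_inj) => /orP[/eqP<-|pj].
    by rewrite ltnn addbF M1p eqxx.
  by rewrite pj M1p andbT addbb -(inj_eq val_inj) (ltn_eqF pj).
move=> /eqP->; rewrite ltnn addbF (negbTE ip) M1c //.
by rewrite ltn_neqAle pi andbT eq_sym.
Qed.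

Lemma reach_diagonal k M : (k <= n)%N -> id_below k M -> exists r M',
  [/\ (k <= r <= n)%N, reach k M M' & forall i j, M' i j = (i == j) && (i < r)%N].
Proof.
have [m mk] : exists m, (n - k)%N = m by exists (n - k)%N.
elim: m k mk M => [|m IHm] k mk M kn Mk.
  exists n, M; split; [lia | exact: ReachEq | move=> i j].
  by rewrite ltn_ord andbT Mk //; have := ltn_ord i; lia.
have k_lt_n : (k < n)%N by lia.
pose p : 'I_n := Ordinal k_lt_n.
have [/existsP[i0 /existsP[j0 /and3P[ki kj Mij]]]|none] :=
    boolP [exists i : 'I_n, exists j : 'I_n, [&& k <= i, k <= j & M i j]%N]; last first.
  exists k, M; split; [by rewrite leqnn | exact: ReachEq | move=> i j].
  have [ik|ki] := ltnP i k; first by rewrite Mk ?ik // andbT.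
  have [jk|kj] := ltnP j k.
    by rewrite Mk ?jk ?orbT // andbF; apply: gtn_eqF (leq_trans jk ki).
  rewrite andbF; apply: contraNF none => Mij.
  by apply/existsP; exists i; apply/existsP; exists j; rewrite ki kj.
(* Additions replace swaps: one column addition and one row addition, when needed, bring a pivot to
   (p, p). *)
have [M1 r1 M1p] : exists2 M1, reach k M M1 & M1 i0 p.
  have [Mip|Mip] := boolP (M i0 p); first by exists M; first exact: ReachEq.
  have jp : j0 != p by apply: contraNneq Mip => <-.
  exists (add_col j0 p M); first by apply: (ReachCol jp) => //; exact: ReachEq.
  by rewrite /add_col eqxx Mij (negbTE Mip).
have [M2 r2 M2p] : exists2 M2, reach k M1 M2 & M2 p p.
  have [Mip|Mip] := boolP (M1 p p); first by exists M1; first exact: ReachEq.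
  have ip : i0 != p by apply: contraNneq Mip => e; rewrite -{1}e.
  exists (add_row i0 p M1); first by apply: (ReachRow ip) => //; exact: ReachEq.
  by rewrite /add_row eqxx M1p (negbTE Mip).
have r12 := reach_trans r1 r2.
have [M3 r3 M3id] := @clear_cross p M2 M2p (reach_id_below r12 Mk).
have [||r [M' [krn r4 M'E]]] := IHm k.+1 _ M3 _ M3id; [lia | lia |].
exists r, M'; split; [lia | | exact: M'E].
exact: reach_trans r12 (reach_trans r3 (reach_le (leqnSn k) r4)).
Qed.

(** Row operations append CNOT gates and column operations prepend them. The relation R is abstract
    because X parts and Z parts are reduced in turn. *)
Lemma reach_circuit k M M' (R : circuit n -> bmx -> Prop) :
    (forall s M1 M2, M1 =2 M2 -> R s M1 -> R s M2) ->
    (forall s M1 a b, a != b -> (k <= a)%N -> (k <= b)%N -> R s M1 ->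
       exists2 g, isCNOT g & R (rcons s g) (add_row a b M1)) ->
    (forall s M1 a b, a != b -> (k <= a)%N -> (k <= b)%N -> R s M1 ->
       exists2 g, isCNOT g & R (g :: s) (add_col a b M1)) ->
  reach k M M' -> forall s, R s M ->
  exists c1 c2, [/\ all isCNOT c1, all isCNOT c2 & R (c1 ++ s ++ c2) M'].
Proof.
move=> Rext Rrow Rcol.
elim=> [{}M {}M' e|a b {}M {}M' ab ka kb _ IH|a b {}M {}M' ab ka kb _ IH] s RM.
- by exists [::], [::]; rewrite cats0; split=> //; apply: Rext RM.
- have [g g_cnot /IH[c1 [c2 [c1P c2P Rc]]]] := Rrow s M a b ab ka kb RM.
  by exists c1, (g :: c2); split; rewrite /= ?g_cnot // -cat_rcons.
- have [g g_cnot /IH[c1 [c2 [c1P c2P Rc]]]] := Rcol s M a b ab ka kb RM.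
  exists (rcons c1 g), c2; split; rewrite ?all_rcons ?g_cnot //.
  by rewrite -cats1 -catA.
Qed.

End Pivoting.

(** * Reduction by CNOT layers, diagonal layers, and the layered form *)

Section NormalForm.
Variable n : nat.
Implicit Types (s c : circuit n) (v w : pauli n) (a b i j k : 'I_n) (r : nat).

Local Notation pauli1 := (false, false).
Local Notation bmx := ('I_n -> 'I_n -> bool).

(** X exponents and Z exponents transform contragrediently: control and target exchange roles. *)
Lemma act_cnot_row (a b : 'I_n) (ba : b != a) v : let u := gate_act (gateCNOT ba) v in
  (forall i, (u i).1 = (v i).1 (+) ((i == a) && (v b).1)) /\
  (forall i, (u i).2 = (v i).2 (+) ((i == b) && (v a).2)).
Proof.
split=> i; rewrite !ffunE.
  have [->|_] := eqVneq i b; first by rewrite (negbTE ba) addbF.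
  by have [->|_] := eqVneq i a; rewrite ?addbF.
have [->|_] //= := eqVneq i b.
by have [->|_] := eqVneq i a; rewrite addbF.
Qed.

Lemma act_cnot_col (a b : 'I_n) (ab : a != b) s j :
  act (gateCNOT ab :: s) (pauliZ j) =
  if j == b then pauli_add (act s (pauliZ j)) (act s (pauliZ a))
  else act s (pauliZ j).
Proof.
rewrite /= -act_add -fun_if; congr (act s _); apply/ffunP => i.
have [->|jb] := eqVneq j b; rewrite !ffunE ?eqxx.
  have [->|_] := eqVneq i a; first by rewrite (negbTE ab).
  by case: (eqVneq i b).
rewrite (eq_sym b) (negbTE jb) addbF.
have [->|_] := eqVneq i a; first by [].
by have [->|_] := eqVneq i b; rewrite //= (eq_sym b) (negbTE jb).
Qed.

Lemma cnot_reduce_x s : exists c1 c2 r,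
  [/\ all isCNOT c1, all isCNOT c2, (r <= n)%N &
    forall i j, (act (c1 ++ s ++ c2) (pauliZ j) i).1 = (i == j) && (i < r)%N].
Proof.
pose M i j := (act s (pauliZ j) i).1.
have [//|//|r [M' [rn sM M'E]]] := @reach_diagonal n 0 M.
pose R s' (M1 : bmx) := forall i j, (act s' (pauliZ j) i).1 = M1 i j.
have [||||c1 [c2 [c1P c2P Rc]]] := reach_circuit (R := R) _ _ _ sM (s := s).
- by move=> s' M1 M2 e RM1 i j; rewrite -e RM1.
- move=> s' M1 a b ab _ _ RM1; exists (gateCNOT ab) => // i j.
  by rewrite act_rcons (act_cnot_row ab _).1 !RM1.
- move=> s' M1 a b ab _ _ RM1; exists (gateCNOT ab) => // i j.
  by rewrite act_cnot_col /add_col -!RM1; case: eqP => [->|_]; rewrite ?ffunE ?addbF.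
- by [].
by exists c1, c2, r; split=> // i j; rewrite Rc M'E.
Qed.

Lemma sform_delta i j v w : (forall k, (v k).1 = (k == i)) ->
  (forall k, (w k).1 = (k == j)) -> sform v w = (w i).2 (+) (v j).2.
Proof.
move=> vi wj; rewrite /sform big_split /=; congr (_ (+) _).
  by rewrite (bigD1 i) //= vi eqxx big1 ?addbF // => k /negbTE ki; rewrite vi ki.
rewrite (bigD1 j) //= wj eqxx andbT big1 ?addbF // => k /negbTE kj.
by rewrite wj kj andbF.
Qed.

Lemma sform_x0 i v w : (forall k, (v k).1 = (k == i)) ->
  (forall k, (w k).1 = false) -> sform v w = (w i).2.
Proof.
move=> vi w0; rewrite /sform (bigD1 i) //= vi eqxx w0 andbF addbF.
by rewrite big1 ?addbF // => k /negbTE ki; rewrite vi ki w0 andbF.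
Qed.

Lemma sformZZ i j : sform (pauliZ i) (pauliZ j) = false.
Proof. by rewrite sformZ ffunE. Qed.

Lemma sformXX i j : sform (pauliX i) (pauliX j) = false.
Proof. by rewrite sformX ffunE. Qed.

(* The images of the Z_j with j >= r are products of Z's; they commute with    *)
(* the other images, hence involve only qubits >= r and form an invertible     *)
(* matrix, reduced to the identity by operations on these qubits alone.        *)
Lemma cnot_reduce s : exists c1 c2 r,
  [/\ all isCNOT c1, all isCNOT c2,
      forall i j, (act (c1 ++ s ++ c2) (pauliZ j) i).1 = (i == j) && (i < r)%N
    & forall j, (r <= j)%N -> act (c1 ++ s ++ c2) (pauliZ j) = pauliZ j].
Proof.
have [c1 [c2 [r [c1P c2P rn xE]]]] := cnot_reduce_x s.
set s1 := c1 ++ s ++ c2 in xE.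
(* Columns below r are filled with the identity so that elimination can start at index r. *)
pose M i j := if (r <= j)%N then (act s1 (pauliZ j) i).2 else i == j.
have x_lt i : (i < r)%N -> forall k, (act s1 (pauliZ i) k).1 = (k == i).
  by move=> ir k; rewrite xE; have [->|] := eqVneq k i; rewrite ?ir.
have x_ge u j : (forall k, (act u (pauliZ j) k).1 = (k == j) && (k < r)%N) ->
    (r <= j)%N -> forall k, (act u (pauliZ j) k).1 = false.
  by move=> uE rj k; rewrite uE; case: eqP => // ->; rewrite ltnNge rj.
have Mr : id_below r M.
  move=> i j ij; rewrite /M; case: leqP => // rj.
  have ir : (i < r)%N by move: ij; rewrite [(j < r)%N]ltnNge rj orbF.
  rewrite -(sform_x0 (x_lt i ir) (x_ge s1 j (xE^~ j) rj)) act_sform sformZZ.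
  by apply/esym/negbTE; rewrite -(inj_eq val_inj) neq_ltn (leq_trans ir rj).
have [r' [M' [/andP[rr' r'n] sM M'E]]] := reach_diagonal rn Mr.
pose R u (M1 : bmx) :=
  (forall i j, (act u (pauliZ j) i).1 = (i == j) && (i < r)%N) /\
  (forall i j, (r <= j)%N -> (act u (pauliZ j) i).2 = M1 i j).
have [||||c3 [c4 [c3P c4P [xE' zE']]]] := reach_circuit (R := R) _ _ _ sM (s := s1).
- by move=> u M1 M2 e [x z]; split=> // i j rj; rewrite -e z.
- move=> u M1 a b ab ra rb [x z]; have ba : b != a by rewrite eq_sym.
  exists (gateCNOT ba) => //; split=> [i j|i j rj].
    rewrite act_rcons (act_cnot_row ba _).1 !x [(b < r)%N]ltnNge rb.
    by rewrite !andbF addbF.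
  by rewrite act_rcons (act_cnot_row ba _).2 !z.
- move=> u M1 a b ab ra rb [x z].
  exists (gateCNOT ab) => //; split=> [i j|i j rj]; rewrite act_cnot_col.
    case: eqP => // _; rewrite ffunE /= !x.
    have [->|_] := eqVneq i a; last by rewrite addbF.
    by rewrite [(a < r)%N]ltnNge ra addbF.
  rewrite /add_col -!z //; case: eqP => [->|_]; rewrite ?ffunE ?addbF //=.
- by split=> // i j rj; rewrite /M rj.
(* Otherwise the image of Z_j for j = r' would be trivial, yet it anticommutes with the image of
   X_j. *)
have r'E : r' = n.
  apply/eqP; rewrite eqn_leq r'n leqNgt; apply/negP => r'_lt.
  pose j : 'I_n := Ordinal r'_lt.
  have := act_sform (c3 ++ s1 ++ c4) (pauliZ j) (pauliX j).
  rewrite sformZ ffunE eqxx /sform big1 // => k _.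
  rewrite (x_ge _ j (xE'^~ j) rr') zE' // M'E.
  by case: eqP => // ->; rewrite ltnn.
exists (c3 ++ c1), (c2 ++ c4), r.
have -> : (c3 ++ c1) ++ s ++ c2 ++ c4 = c3 ++ s1 ++ c4 by rewrite /s1 -!catA.
split; rewrite ?all_cat ?c1P ?c2P ?c3P ?c4P //.
move=> j rj; apply/ffunP => i; rewrite [LHS]surjective_pairing ffunE.
by rewrite (x_ge _ j (xE'^~ j) rj) zE' // M'E r'E ltn_ord andbT.
Qed.

Section DiagonalLayers.
Variable A : bmx.
Hypothesis A_sym : forall i j, A i j = A j i.

Let term k v (p : 'I_n * 'I_n) := A p.1 p.2 &&
  (((k == p.1) && (v p.2).1) (+) ((k == p.2) && (v p.1).1)).

Lemma cz_circuit (L : seq ('I_n * 'I_n)) : all (fun p => p.1 != p.2) L ->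
  exists2 c, all isCZ c & forall v k,
    act c v k = ((v k).1, (v k).2 (+) \big[addb/false]_(p <- L) term k v p).
Proof.
elim: L => [_|[a b] L IHL /= /andP[ab /IHL[c cP cE]]].
  by exists [::] => // v k; rewrite big_nil addbF; case: (v k).
case Aab : (A a b); last first.
  by exists c => // v k; rewrite big_cons {1}/term /= Aab cE.
exists (rcons c (gateCZ ab)) => [|v k]; first by rewrite all_rcons.
rewrite act_rcons big_cons {1}/term Aab /= !ffunE !cE /=.
have [->|_] := eqVneq k a; first by rewrite (negbTE ab) addbF addbA addbAC.
by have [->|_] := eqVneq k b; rewrite //= addbA addbAC.
Qed.

Lemma p_circuit (l : seq 'I_n) : uniq l ->
  exists2 c, all isP c & forall v k,
    act c v k = ((v k).1, (v k).2 (+) [&& k \in l, A k k & (v k).1]).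
Proof.
elim: l => [_|a l IHl /= /andP[al /IHl[c cP cE]]].
  by exists [::] => // v k; rewrite addbF; case: (v k).
case Aa : (A a a); last first.
  exists c => // v k; rewrite cE inE; congr (_, _ (+) _).
  by case: eqP => // ->; rewrite Aa andbF.
exists (rcons c (gateP a)) => [|v k]; first by rewrite all_rcons.
rewrite act_rcons !ffunE !cE /= inE.
by have [->|_] //= := eqVneq k a; rewrite (negbTE al) Aa /= addbF.
Qed.

(** These layers add A x to the Z exponents, where x is the vector of X exponents: CZ gates realize
    the off-diagonal entries and P gates the diagonal. Both orders are needed, as the two halves of
    the layered form mirror each other. *)
Lemma quadratic_layers : exists c p, [/\ all isCZ c, all isP p &
  forall v k, let u := ((v k).1, (v k).2 (+) \big[addb/false]_j (A k j && (v j).1)) in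
    act (c ++ p) v k = u /\ act (p ++ c) v k = u].
Proof.
pose L := [seq p : 'I_n * 'I_n <- enum {: 'I_n * 'I_n} | (p.1 < p.2)%N].
have [|c cP cE] := @cz_circuit L.
  apply/allP => -[i j]; rewrite mem_filter /= => /andP[ij _].
  by rewrite -(inj_eq val_inj) neq_ltn ij.
have [p pP pE] := p_circuit (enum_uniq 'I_n).
have LE k v : \big[addb/false]_(p <- L) term k v p =
    \big[addb/false]_(j | j != k) (A k j && (v j).1).
  pose x j := (v j).1.
  (* Each unordered pair occurs once, as i < j; qubit k receives contributions from pairs where it
     comes first and from pairs where it comes second. *)
  transitivity (\big[addb/false]_(i < n) \big[addb/false]_(j < n | (i < j)%N)
      ((k == i) && (A i j && x j) (+) (k == j) && (A i j && x i))).
    rewrite pair_big_dep big_filter big_enum_cond /=.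
    by apply: eq_bigr => -[i j] _; rewrite /term /= andb_addr !(andbCA (A i j)).
  rewrite (eq_bigr _ (fun i _ => big_split _ _ _ _ _)) big_split /=.
  rewrite [X in _ (+) X](exchange_big_dep xpredT) //=.
  rewrite (bigD1 k) //= eqxx [X in _ (+) X (+) _]big1 ?addbF; last first.
    by move=> i /negbTE ik; apply: big1 => j _; rewrite eq_sym ik.
  rewrite [X in _ (+) X](bigD1 k) //= eqxx [X in _ (+) (_ (+) X)]big1 ?addbF;
    last first.
    by move=> j /negbTE jk; apply: big1 => i _; rewrite eq_sym jk.
  rewrite [RHS](bigID (fun j : 'I_n => (k < j)%N)) /=; congr (_ (+) _).
    by apply: eq_bigl => j; rewrite -(inj_eq val_inj) neq_ltn; case: ltngtP.
  rewrite (eq_bigr (fun i => A k i && x i)) => [|i _]; last by rewrite A_sym.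
  by apply: eq_bigl => j; rewrite -(inj_eq val_inj) neq_ltn; case: ltngtP.
exists c, p; split=> // v k u.
have uE : u = ((v k).1, (v k).2 (+) ((A k k && (v k).1)
    (+) \big[addb/false]_(j | j != k) (A k j && (v j).1))).
  by rewrite /u (bigD1 k).
rewrite !act_cat uE; split; rewrite !(pE, cE) !LE /= mem_enum /=; congr (_, _).
  by rewrite addbA addbAC.
by rewrite addbA; congr (_ (+) _); apply: eq_bigr => j _; rewrite pE.
Qed.

End DiagonalLayers.

Lemma h_circuit (S : pred 'I_n) (l : seq 'I_n) : uniq l ->
  exists2 c, all isH c & forall v k,
    act c v k = if (k \in l) && S k then ((v k).2, (v k).1) else v k.
Proof.
elim: l => [_|a l IHl /= /andP[al /IHl[c cP cE]]]; first by exists [::].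
case Sa : (S a); last first.
  exists c => // v k; rewrite cE inE.
  by case: eqP => // ->; rewrite Sa andbF.
exists (rcons c (gateH a)) => [|v k]; first by rewrite all_rcons.
rewrite act_rcons !ffunE !cE inE.
by have [->|_] //= := eqVneq k a; rewrite (negbTE al) Sa /=.
Qed.

Lemma normal_form_act s : exists c1 z1 p1 h p2 z2 c2,
  [/\ all isCNOT c1 && all isCNOT c2, all isCZ z1 && all isCZ z2,
      all isP p1 && all isP p2, all isH h
    & act (c1 ++ z1 ++ p1 ++ h ++ p2 ++ z2 ++ c2) =1 act s].
Proof.
have [c1 [c2 [r [c1P c2P xE zE]]]] := cnot_reduce s.
set s1 := c1 ++ s ++ c2 in xE zE.
have x_lt i : (i < r)%N -> forall k, (act s1 (pauliZ i) k).1 = (k == i).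
  by move=> ir k; rewrite xE; have [->|] := eqVneq k i; rewrite ?ir.
(* Columns j < r hold the Z's to be removed; the others are filled in by symmetry. On the first r
   indices, symmetry expresses that the images of the Z_j commute. *)
pose A i j := if (j < r)%N then (act s1 (pauliZ j) i).2
  else (i < r)%N && (act s1 (pauliZ i) j).2.
have A_sym i j : A i j = A j i.
  rewrite /A; case: (ltnP i r) (ltnP j r) => [ir|_] [jr|_] //=.
  have := act_sform s1 (pauliZ i) (pauliZ j).
  rewrite (sform_delta (x_lt i ir) (x_lt j jr)) sformZZ.
  by case: (_ i).2; case: (_ j).2.
have [z1 [p1 [z1P p1P zp1E]]] := quadratic_layers A_sym.
have [h hP hE] := h_circuit (fun k => k < r)%N (enum_uniq 'I_n).
pose s2 := s1 ++ (z1 ++ p1) ++ h.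
have s2Z j : act s2 (pauliZ j) = pauliZ j.
  rewrite /s2 act_cat [act ((_ ++ _) ++ _) _]act_cat; apply/ffunP => k.
  rewrite hE mem_enum (zp1E _ k).1 /=.
  have [jr|rj] := ltnP j r.
    rewrite (bigD1 j) //= big1 => [|i /negbTE ij]; last by rewrite x_lt // ij andbF.
    rewrite x_lt // x_lt // eqxx andbT addbF /A jr addbb ffunE.
    have [->|kj] := eqVneq k j; first by rewrite jr.
    by case: ifP.
  rewrite zE // big1 => [|i _]; last by rewrite ffunE andbF.
  rewrite ffunE addbF /=.
  by case: ltnP => // kr; rewrite -(inj_eq val_inj) (ltn_eqF (leq_trans kr rj)).
(* Every Z_k is restored by now, so the relations with Z_k determine the X part of the image of
   X_j. *)
have s2X j k : (act s2 (pauliX j) k).1 = (k == j).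
  by rewrite -sformZ -(s2Z k) act_sform sformZ ffunE.
pose B i j := (act s2 (pauliX j) i).2.
have B_sym i j : B i j = B j i.
  have := act_sform s2 (pauliX i) (pauliX j).
  rewrite (sform_delta (s2X i) (s2X j)) sformXX /B.
  by case: (_ i).2; case: (_ j).2.
have [z2 [p2 [z2P p2P zp2E]]] := quadratic_layers B_sym.
have s3_id : act (s2 ++ p2 ++ z2) =1 id.
  apply: act_id => j; apply/ffunP => k; rewrite act_cat (zp2E _ k).2.
    rewrite s2Z big1 => [|i _]; last by rewrite ffunE andbF.
    by rewrite ffunE addbF.
  rewrite (bigD1 j) //= big1 => [|i /negbTE ij]; last by rewrite s2X ij andbF.
  by rewrite !s2X eqxx andbT addbF addbb ffunE.
(* Solving c1 s c2 z1 p1 h p2 z2 = id for s. *)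
exists (rev c1), (rev z2), (rev p2), (rev h), (rev p1), (rev z1), (rev c2).
split; rewrite ?all_rev ?c1P ?c2P ?z1P ?z2P ?p1P ?p2P ?hP // => v.
have <- : act s (act c1 (act (rev c1) v)) = act s v by rewrite act_revK.
rewrite act_cat; set w := act (rev c1) v.
have := s3_id w; rewrite /s2 /s1 -!catA.
rewrite act_cat act_cat => e; rewrite -[in LHS]e.
have -> : rev z2 ++ rev p2 ++ rev h ++ rev p1 ++ rev z1 ++ rev c2 =
    rev (c2 ++ z1 ++ p1 ++ h ++ p2 ++ z2) by rewrite !rev_cat -!catA.
exact: act_rev.
Qed.

End NormalForm.

Theorem corollary14 (C : numClosedFieldType) (n : nat) (n_ge1 : (1 <= n)%N)
    (s : circuit n) (s_stab : all stabilizer_gate s) :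
  (exists (phase : C) (Q V : operator C n),
     [/\ `|phase| = 1,
         is_pauli Q,
         is_layered [:: isCNOT; isCZ; isP; isH; isP; isCZ; isCNOT] V
       & circuit_op C s = phase *: (Q *m V)]) /\
  (exists (s' : circuit n) (d : nat),
     [/\ all stabilizer_gate s',
         all nearest_neighbor s',
         has_depth s' d,
         (d <= 14 * n - 4)%N
       & circuit_op C s' = circuit_op C s]).
Proof.
split.
  have [c1 [z1 [p1 [h [p2 [z2 [c2 []]]]]]]] := normal_form_act s.
  move=> /andP[c1P c2P] /andP[z1P z2P] /andP[p1P p2P] hP nfE.
  have [m [w sE]] := circuit_op_of_act C (fsym nfE).
  have [c [Q [c1_norm Q_pauli wE]]] := is_pauli_op C w.
  exists (zeta8 C ^+ m * c), Q, (circuit_op C (c1 ++ z1 ++ p1 ++ h ++ p2 ++ z2 ++ c2)).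
  split=> //; last by rewrite sE wE -scalemxAl scalerA.
    by rewrite normrM c1_norm mulr1 normrX norm_zeta8 expr1n.
  by rewrite -[c2]cats0; do 7!(apply: is_layered_cat => //).
have [b [d [b_stab b_nn b_depth d_le bE]]] := lnn_act s.
(* Qubit 0 carries the gates that produce the global phase. *)
have [q q_single qE] := single_qubit_fix C (Ordinal n_ge1) (fsym bE).
exists (b ++ q), d; split=> //.
- rewrite all_cat b_stab; apply: sub_all q_single => g.
  by rewrite /single_qubit /stabilizer_gate orbA => ->.
- rewrite all_cat b_nn; apply: sub_all q_single; by case.
- exact: has_depth_cat_single.
- by lia.
Qed.
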